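(* Let $A, Z \in \mathbb{C}^{M \times N}$ with $\operatorname{rank} Z = r$ be given. Then in $O(MNr)$ operations it is possible to find rows $R \in \mathbb{C}^{r \times N}$ and columns $C \in \mathbb{C}^{M \times r}$ of the matrix $A$ such that simultaneously $$\| A - C C^+ A R^+ R \|_F \leqslant \sqrt{2r + 2}\, \| A - Z \|_F$$ and $$\| A - C C^+ A R^+ R \|_2 \leqslant \sqrt{2 + 2r ( \min ( M, N ) - r )}\, \| A - Z \|_2 .$$ In the same number of operations it is also possible to select the same rows $R \in \mathbb{C}^{r \times N}$, but maybe different columns $C \in \mathbb{C}^{M \times r}$ of $A$, such that simultaneously $$\| A - C \hat A^{-1} R \|_F \leqslant ( r + 1 ) \| A - Z \|_F$$ and $$\| A - C \hat A^{-1} R \|_2 \leqslant \sqrt{ 1 + r ( r + 2 ) ( \min (M, N) - r ) }\, \| A - Z \|_2 ,$$ where $\hat A \in \mathbb{C}^{r \times r}$ is the submatrix at the intersection of the rows $R$ and the columns $C$.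
   Context: ''Columns $C\in\mathbb{C}^{M\times r}$ of $A$'' (resp. ''rows $R\in\mathbb{C}^{r\times N}$ of $A$'') means the submatrix of $A$ formed by $r$ of its columns (resp. rows). $\|\cdot\|_F$ is the Frobenius norm, $\|\cdot\|_2$ is the spectral norm, and $X^+$ is the Moore–Penrose pseudoinverse of $X$. Operations are arithmetic operations, the input being the matrices $A$ and $Z$.
   Formalization: The second pair of bounds (with Â⁻¹) is stated only when r ≤ rank A, where Â is proved invertible; if rank A < r (e.g. A = 0, Z = 1, r = 1) no r×r submatrix of A is invertible and the claim has no meaning. *)

(* Defs.v *)
From HB Require Import structures.
From mathcomp Require Import all_boot all_order all_algebra.
From mathcomp Require Import complex.
From mathcomp Require Import boolp classical_sets reals.

Set Implicit Arguments.
Unset Strict Implicit.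
Unset Printing Implicit Defensive.

Import Order.TTheory GRing.Theory Num.Theory.

Local Open Scope classical_set_scope.
Local Open Scope ring_scope.
Local Open Scope complex_scope.

Section Norms.
Variable R : realType.
Implicit Types M N : nat.

Definition frob_norm M N (A : 'M[R[i]]_(M, N)) : R :=
  Num.sqrt (\sum_i \sum_j ComplexField.Normc.normc (A i j) ^+ 2).

(* On column vectors [frob_norm] is the Euclidean norm, so this is the operator
   norm subordinate to it. *)
Definition spectral_norm M N (A : 'M[R[i]]_(M, N)) : R :=
  sup [set frob_norm (A *m x) | x in [set x : 'cV[R[i]]_N | frob_norm x <= 1]].

Definition ctrmx M N (A : 'M[R[i]]_(M, N)) : 'M[R[i]]_(N, M) :=
  map_mx Num.conj A^T.

Definition penrose M N (A : 'M[R[i]]_(M, N)) (X : 'M[R[i]]_(N, M)) : Prop :=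
  [/\ A *m X *m A = A, X *m A *m X = X,
      ctrmx (A *m X) = A *m X & ctrmx (X *m A) = X *m A].

(* Existence and uniqueness are proved below, so the default value 0 is never
   used. *)
Definition pinvmp M N (A : 'M[R[i]]_(M, N)) : 'M[R[i]]_(N, M) :=
  xget 0 [set X | penrose A X].

Lemma ctrmxM M N P (A : 'M[R[i]]_(M, N)) (B : 'M[R[i]]_(N, P)) :
  ctrmx (A *m B) = ctrmx B *m ctrmx A.
Proof. by rewrite /ctrmx trmx_mul map_mxM. Qed.

Lemma ctrmxK M N (A : 'M[R[i]]_(M, N)) : ctrmx (ctrmx A) = A.
Proof. by apply/matrixP=> i j; rewrite !mxE conjCK. Qed.

Lemma mul_ctrmx_eq0 M N (A : 'M[R[i]]_(M, N)) : A *m ctrmx A = 0 -> A = 0.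
Proof.
move=> A0; apply/matrixP=> i j; rewrite mxE.
have : (A *m ctrmx A) i i = 0 by rewrite A0 mxE.
rewrite mxE (eq_bigr (fun k => `|A i k| ^+ 2)); last first.
  by move=> k _; rewrite !mxE normCK.
move=> /eqP; rewrite psumr_eq0; last by move=> k _; rewrite exprn_ge0.
by move=> /allP/(_ j (mem_index_enum _)) /=; rewrite expf_eq0 /= normr_eq0 => /eqP.
Qed.

Lemma gram_unitmx M N (A : 'M[R[i]]_(M, N)) :
  row_free A -> A *m ctrmx A \in unitmx.
Proof.
move=> fA; rewrite -row_free_unit -kermx_eq0; apply/eqP.
set K := kermx _.
have K0 : K *m (A *m ctrmx A) = 0 by apply/sub_kermxP.
have /mul_ctrmx_eq0 KA : (K *m A) *m ctrmx (K *m A) = 0.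
  by rewrite ctrmxM mulmxA -(mulmxA K) K0 mul0mx.
by apply: (row_free_inj fA); rewrite KA mul0mx.
Qed.

Lemma penrose_exists M N (A : 'M[R[i]]_(M, N)) : exists X, penrose A X.
Proof.
have: exists k (L : 'M_(M, k)) (U : 'M_(k, N)),
    [/\ A = L *m U, row_full L & row_free U].
  exists (\rank A), (col_base A), (row_base A).
  by rewrite mulmx_base col_base_full row_base_free.
move=> [k [L [U [eA fL fU]]]].
pose G := U *m ctrmx U; pose H := ctrmx L *m L.
have uG : G \in unitmx by apply: gram_unitmx.
have uH : H \in unitmx.
  have: row_free (ctrmx L) by rewrite /row_free /ctrmx mxrank_map mxrank_tr.
  by move=> /gram_unitmx; rewrite ctrmxK.
have inv_herm n (B : 'M[R[i]]_n) : B \in unitmx -> ctrmx B = B ->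
    ctrmx (invmx B) = invmx B.
  move=> uB hB; rewrite -[LHS](mulmxK uB) -{2}hB -ctrmxM mulmxV //.
  by rewrite {1}/ctrmx trmx1 map_mx1 mul1mx.
have hG : ctrmx (invmx G) = invmx G by apply: inv_herm => //; rewrite ctrmxM ctrmxK.
have hH : ctrmx (invmx H) = invmx H by apply: inv_herm => //; rewrite ctrmxM ctrmxK.
pose X := ctrmx U *m invmx G *m invmx H *m ctrmx L.
have AX : A *m X = L *m invmx H *m ctrmx L.
  by rewrite eA /X !mulmxA -(mulmxA L U) -/G -(mulmxA L G) mulmxV // mulmx1.
have XA : X *m A = ctrmx U *m invmx G *m U.
  rewrite eA /X -!mulmxA (mulmxA (ctrmx L)) -/H (mulmxA (invmx H)) mulVmx //.
  by rewrite mul1mx.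
exists X; split.
- rewrite AX eA -!mulmxA (mulmxA (ctrmx L)) -/H (mulmxA (invmx H)) mulVmx //.
  by rewrite mul1mx.
- rewrite XA /X !mulmxA -(mulmxA _ U) -/G -(mulmxA _ (invmx G) G) mulVmx //.
  by rewrite mulmx1.
- by rewrite AX !ctrmxM ctrmxK hH mulmxA.
- by rewrite XA !ctrmxM ctrmxK hG mulmxA.
Qed.

Lemma penrose_unique M N (A : 'M[R[i]]_(M, N)) X Y :
  penrose A X -> penrose A Y -> X = Y.
Proof.
move=> [AXA XAX hAX hXA] [AYA YAY hAY hYA].
have eAX : A *m X = A *m Y.
  by rewrite -hAX -{1}AYA -mulmxA ctrmxM hAX hAY mulmxA AXA.
have eXA : X *m A = Y *m A.
  by rewrite -hXA -{1}AYA -mulmxA mulmxA ctrmxM hXA hYA -mulmxA (mulmxA A) AXA.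
by rewrite -XAX -mulmxA eAX mulmxA eXA YAY.
Qed.

Lemma pinvmpP M N (A : 'M[R[i]]_(M, N)) : penrose A (pinvmp A).
Proof. by have [X pX] := penrose_exists A; exact: (xgetPex 0 (ex_intro _ X pX)). Qed.

End Norms.

(* Complexity model: a fixed, finite program over the field of complex numbers,
   the same one for all sizes, acting on two kinds of memory:
   - integer arrays [imem a], entry k being [imem a k] (array a also serves as
     the integer register [imem a 0]); these hold sizes, loop counters and
     selected indices;
   - two-dimensional scalar arrays [smem a], entry (i, j) being [smem a i j].
   Scalars influence integers and control flow only through the comparison in
   [CIfS].  Every command that reads or writes a scalar costs one operation
   (arithmetic, conjugation, comparison, copies and constants); integer
   bookkeeping is free, as only arithmetic operations on scalars are counted.
   Loops are bounded by integers known at entry, so execution always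
   terminates. *)

Inductive iexp : Type :=
| INum (n : nat)
| IAt (a : nat) (e : iexp)
| IAdd (e1 e2 : iexp)
| ISub (e1 e2 : iexp)
| IMul (e1 e2 : iexp).

Record loc : Type := Loc { loc_arr : nat; loc_row : iexp; loc_col : iexp }.

Inductive aop : Type := OpAdd | OpSub | OpMul | OpDiv.

Inductive cmd : Type :=
| CSkip
| CISet (a : nat) (e v : iexp)
| CConst (d : loc) (n : nat)
| CCopy (d x : loc)
| CConj (d x : loc)
| CArith (o : aop) (d x y : loc)
| CSeq (c1 c2 : cmd)
| CIfI (e1 e2 : iexp) (c1 c2 : cmd)
| CIfS (x y : loc) (c1 c2 : cmd)
| CFor (a : nat) (e : iexp) (c : cmd).

Section Semantics.
Variable R : realType.

Record state : Type := State {
  imem : nat -> nat -> nat;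
  smem : nat -> nat -> nat -> R[i];
  ops : nat
}.

Fixpoint ieval (s : state) (e : iexp) : nat :=
  match e with
  | INum n => n
  | IAt a e1 => imem s a (ieval s e1)
  | IAdd e1 e2 => (ieval s e1 + ieval s e2)%N
  | ISub e1 e2 => (ieval s e1 - ieval s e2)%N
  | IMul e1 e2 => (ieval s e1 * ieval s e2)%N
  end.

Definition iset (s : state) (a k v : nat) : state :=
  State (fun b l => if (b == a) && (l == k) then v else imem s b l)
        (smem s) (ops s).

Definition sget (s : state) (x : loc) : R[i] :=
  smem s (loc_arr x) (ieval s (loc_row x)) (ieval s (loc_col x)).

Definition sset (s : state) (d : loc) (z : R[i]) : state :=
  State (imem s)
        (fun b k l => if [&& b == loc_arr d, k == ieval s (loc_row d)
                           & l == ieval s (loc_col d)]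
                      then z else smem s b k l)
        (ops s).

Definition tick (s : state) : state := State (imem s) (smem s) (ops s).+1.

(* Division by zero returns 0, as everywhere in the library. *)
Definition aeval (o : aop) (x y : R[i]) : R[i] :=
  match o with
  | OpAdd => x + y
  | OpSub => x - y
  | OpMul => x * y
  | OpDiv => x / y
  end.

Fixpoint exec (c : cmd) (s : state) : state :=
  match c with
  | CSkip => s
  | CISet a e v => iset s a (ieval s e) (ieval s v)
  | CConst d n => tick (sset s d n%:R)
  | CCopy d x => tick (sset s d (sget s x))
  | CConj d x => tick (sset s d (Num.conj (sget s x)))
  | CArith o d x y => tick (sset s d (aeval o (sget s x) (sget s y)))
  | CSeq c1 c2 => exec c2 (exec c1 s)
  | CIfI e1 e2 c1 c2 =>
      if (ieval s e1 <= ieval s e2)%N then exec c1 s else exec c2 s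
  | CIfS x y c1 c2 =>
      if complex.Re (sget s x) <= complex.Re (sget s y)
      then exec c1 (tick s) else exec c2 (tick s)
  | CFor a e c1 => iteri (ieval s e) (fun k s' => exec c1 (iset s' a 0 k)) s
  end.

Definition entry M N (A : 'M[R[i]]_(M, N)) (k l : nat) : R[i] :=
  if (insub k, insub l) is (Some i, Some j) then A i j else 0.

(* Initially the integer registers 0, 1, 2 hold M, N, r and the scalar arrays
   0, 1 hold A, Z; everything else is 0. *)
Definition init M N (r : nat) (A Z : 'M[R[i]]_(M, N)) : state :=
  State (fun a k => if k == 0%N then nth 0%N [:: M; N; r] a else 0%N)
        (fun a => match a with 0 => entry A | 1 => entry Z | _ => fun _ _ => 0 end)
        0.

Definition selects (s : state) (a r n : nat) (f : 'I_r -> 'I_n) : Prop :=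
  injective f /\ forall k : 'I_r, imem s a k = f k.

End Semantics.

(* Main.v *)
(* Let P be the orthogonal projector on an r-dimensional space of rows and
   E = A (1 - P).  Since sum_j P_jj = r and sum_j |e_j|^2 = |E|_F^2, some column
   j has |e_j|^2 / P_jj <= |E|_F^2 / r.  Eliminating it, i.e. multiplying by
   1 - P_jj^-1 delta_j p with p the j-th row of P, turns P into a projector of
   rank r - 1 and E into a matrix orthogonal to it whose squared norm grew by at
   most |E|_F^2 / r.  After r steps P has become 0, so A has become A - C Y, with
   C the selected columns, and |A - C Y|_F^2 <= (r + 1) |E|_F^2: this is a greedy
   derandomization of volume sampling, at O(MN) operations per step.

   Starting from the projector P_A on the columns of Z, take P_B containing the
   rows of P_A A, then P_C containing the columns of A P_B.  This gives
   A (1 - P_B) = (1 - P_A) A (1 - P_B), so that both |E|_2 and |E|_F are bounded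
   by those of A - Z, while |E|_F^2 <= (min(M, N) - r) |E|_2^2.  P_B selects the
   columns C and P_C the rows R; the projector on the rows of R then selects the
   second set of columns, for which C Y = C Ahat^-1 R.  When r <= rank A the rows
   of A are used to complete P_B, and this forces R to have rank r.

   Projectors are stored as sums of at most 2r terms q^* q / d, built by
   Gram-Schmidt without normalization (hence without square roots): each pivot
   step appends the term - p^* p / P_jj. *)
Require Import Defs.
From mathcomp Require Import all_boot all_order all_algebra.
From mathcomp Require Import complex.
From mathcomp Require Import boolp classical_sets reals.
From mathcomp Require Import ring lra zify.

Set Implicit Arguments.
Unset Strict Implicit.
Unset Printing Implicit Defensive.

Import Order.TTheory GRing.Theory Num.Theory.
Local Open Scope ring_scope.
Local Open Scope complex_scope.

(** * Scalar expressions with sums, frames and costs *)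

(** Where the constants come from: with G and H the projectors on the chosen columns and rows, A - G
    A H = (1 - G) A + G A (1 - H) is a sum of two matrices with orthogonal column spaces, each
    dominated by a one-sided error A - C Y or A - Y' R; this gives the factor 2. In the second pair
    of bounds the errors compose: the columns are selected relative to the projector on the rows of
    R, whose residual is already an error of the row selection, so the squared Frobenius norm picks
    up r + 1 twice. In the spectral norm the contributions add: elimination leaves the component A
    (1 - P) unchanged, and only the orthogonal component is estimated through the Frobenius norm.

    The obstacle is rank deficiency of A: every projector must have rank exactly r for r indices to
    be selected. So each Gram-Schmidt pass ends with the rows of Z or of its transpose, of rank r,
    and they enter only if the vectors to capture and the rows of A (or of its transpose) do not
    suffice. *)

Inductive sexp : Type :=
| SLoc (l : loc)
| SNum (n : nat)
| SConj (e : sexp)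
| SOp (o : aop) (e1 e2 : sexp)
| SSum (a : nat) (b : iexp) (e : sexp).

(** The data of the program live in scalar arrays below this index, the temporaries of compiled
    expressions at or above it. *)
Definition tmp_base : nat := 20.

Definition tmp (d : nat) : loc := Loc d (INum 0) (INum 0).

(** Stack discipline: the value ends in [tmp d] and no array below d is written, so a left operand
    or a partial sum survives at depth d while the rest is computed at depth [d.+1]. *)
Fixpoint compile (d : nat) (e : sexp) : cmd :=
  match e with
  | SLoc l => CCopy (tmp d) l
  | SNum n => CConst (tmp d) n
  | SConj e1 => CSeq (compile d e1) (CConj (tmp d) (tmp d))
  | SOp o e1 e2 =>
      CSeq (compile d e1)
           (CSeq (compile d.+1 e2) (CArith o (tmp d) (tmp d) (tmp d.+1)))
  | SSum a b e1 =>
      CSeq (CConst (tmp d) 0)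
           (CFor a b (CSeq (compile d.+1 e1)
                           (CArith OpAdd (tmp d) (tmp d) (tmp d.+1))))
  end.

Fixpoint sum_regs (e : sexp) : seq nat :=
  match e with
  | SConj e1 => sum_regs e1
  | SOp _ e1 e2 => sum_regs e1 ++ sum_regs e2
  | SSum a _ e1 => a :: sum_regs e1
  | _ => [::]
  end.

Fixpoint iexp_avoids (L : seq nat) (e : iexp) : bool :=
  match e with
  | INum _ => true
  | IAt a e1 => (a \notin L) && iexp_avoids L e1
  | IAdd e1 e2 | ISub e1 e2 | IMul e1 e2 => iexp_avoids L e1 && iexp_avoids L e2
  end.

(** A sum sets its counter before each evaluation of the summand, which may therefore read it even
    if it was clobbered; hence the filter. The bound is evaluated before that. *)
Fixpoint sexp_avoids (L : seq nat) (p : pred nat) (e : sexp) : bool :=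
  match e with
  | SLoc l => [&& p (loc_arr l), iexp_avoids L (loc_row l) & iexp_avoids L (loc_col l)]
  | SNum _ => true
  | SConj e1 => sexp_avoids L p e1
  | SOp _ e1 e2 => sexp_avoids L p e1 && sexp_avoids L p e2
  | SSum a b e1 => iexp_avoids L b && sexp_avoids [seq x <- L | x != a] p e1
  end.

(** A right operand runs after the left one has clobbered its counters, and a summand after the
    previous iterations have clobbered its own: neither may read these counters outside their
    sums. *)
Fixpoint sexp_wf (e : sexp) : bool :=
  match e with
  | SLoc l => (loc_arr l < tmp_base)%N
  | SNum _ => true
  | SConj e1 => sexp_wf e1
  | SOp _ e1 e2 =>
      [&& sexp_wf e1, sexp_wf e2 & sexp_avoids (sum_regs e1) (fun a => a < tmp_base)%N e2]
  | SSum a b e1 =>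
      sexp_wf e1 && sexp_avoids (sum_regs e1) (fun a => a < tmp_base)%N e1
  end.

(* [row0 + i] ranges over the rows written, so that one row, one column and a
   single entry are all instances. *)
Definition fill (a : nat) (row0 ei ej : iexp) (i j : nat) (e : sexp) : cmd :=
  CFor i ei (CFor j ej
    (CSeq (compile tmp_base e)
          (CCopy (Loc a (IAdd row0 (IAt i (INum 0))) (IAt j (INum 0))) (tmp tmp_base)))).

(** [row0] and [ej] are evaluated again during the loops, so they must not read a clobbered counter,
    whereas [ei] is evaluated once at entry. The array being overwritten must not occur in [e]. *)
Definition fill_wf (a : nat) (row0 ej : iexp) (i j : nat) (e : sexp) : bool :=
  let L := [:: i, j & sum_regs e] in
  [&& uniq [:: i; j], i \notin sum_regs e, j \notin sum_regs e,
      iexp_avoids L row0, iexp_avoids L ej, (a < tmp_base)%N, sexp_wf e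
    & sexp_avoids (sum_regs e) (fun b => (b < tmp_base)%N && (b != a)) e].

Fixpoint writes_int (c : cmd) : seq nat :=
  match c with
  | CISet a _ _ => [:: a]
  | CSeq c1 c2 | CIfI _ _ c1 c2 | CIfS _ _ c1 c2 => writes_int c1 ++ writes_int c2
  | CFor a _ c1 => a :: writes_int c1
  | _ => [::]
  end.

Fixpoint writes_sc (c : cmd) : seq nat :=
  match c with
  | CConst d _ | CCopy d _ | CConj d _ | CArith _ d _ _ => [:: loc_arr d]
  | CSeq c1 c2 | CIfI _ _ c1 c2 | CIfS _ _ c1 c2 => writes_sc c1 ++ writes_sc c2
  | CFor _ _ c1 => writes_sc c1
  | _ => [::]
  end.

Fixpoint bounds_avoid (L : seq nat) (c : cmd) : bool :=
  match c with
  | CSeq c1 c2 | CIfI _ _ c1 c2 | CIfS _ _ c1 c2 => bounds_avoid L c1 && bounds_avoid L c2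
  | CFor _ e c1 => iexp_avoids L e && bounds_avoid L c1
  | _ => true
  end.

Arguments fill : simpl never.

Section Execution.
Variable R : realType.
Implicit Types s : state R.

Fixpoint seval s (e : sexp) : R[i] :=
  match e with
  | SLoc l => sget s l
  | SNum n => n%:R
  | SConj e1 => Num.conj (seval s e1)
  | SOp o e1 e2 => aeval o (seval s e1) (seval s e2)
  | SSum a b e1 => \sum_(k < ieval s b) seval (iset s a 0 k) e1
  end.

(* Loops clobber only the cells [imem a 0] of their counters [a], hence the
   exemption of the other cells. *)
Definition agree (L : seq nat) s s' :=
  forall a l, (l != 0%N) || (a \notin L) -> imem s a l = imem s' a l.

Lemma agree_sub L L' s s' : agree L s s' -> {subset L <= L'} -> agree L' s s'.
Proof.
move=> ss LL' a l /orP[l0|aL]; apply: ss; first by rewrite l0.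
by rewrite (contra (@LL' a)) ?orbT.
Qed.

Lemma agree_trans L s1 s2 s3 : agree L s1 s2 -> agree L s2 s3 -> agree L s1 s3.
Proof. by move=> s12 s23 a l al; rewrite s12 ?s23. Qed.

Lemma agree_iset_self a k s : agree [:: a] (iset s a 0 k) s.
Proof.
move=> b l; rewrite inE /=; case: (b == a) => //=; first by rewrite orbF => /negPf->.
Qed.

Lemma agree_iset L a k s s' :
  agree L s s' -> agree [seq x <- L | x != a] (iset s a 0 k) (iset s' a 0 k).
Proof.
move=> ss b l; rewrite mem_filter /=; case: (eqVneq b a) => [->|ba] /=.
  by case: eqVneq => // l0 _; apply: ss; rewrite l0.
by move=> bl; apply: ss.
Qed.

Lemma ieval_agree L s s' e :
  agree L s s' -> iexp_avoids L e -> ieval s e = ieval s' e.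
Proof.
move=> ss; elim: e => //= [a e IH /andP[aL /IH->]|e1 IH1 e2 IH2 /andP[/IH1-> /IH2->]
  |e1 IH1 e2 IH2 /andP[/IH1-> /IH2->]|e1 IH1 e2 IH2 /andP[/IH1-> /IH2->]] //.
by apply: ss; rewrite aL orbT.
Qed.

Lemma seval_agree L (p : pred nat) s s' e :
  agree L s s' -> (forall a, p a -> forall x y, smem s a x y = smem s' a x y) ->
  sexp_avoids L p e -> seval s e = seval s' e.
Proof.
elim: e L s s' => //= [l|e IH|o e1 IH1 e2 IH2|a b e IH] L s s' ss pp.
- case/and3P=> pl or oc; rewrite /sget (ieval_agree ss or) (ieval_agree ss oc).
  exact: pp.
- by move=> /(IH _ _ _ ss pp)->.
- by case/andP=> /(IH1 _ _ _ ss pp)-> /(IH2 _ _ _ ss pp)->.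
- case/andP=> ob oe; rewrite (ieval_agree ss ob); apply: eq_bigr => k _.
  by apply: IH oe => //; exact: agree_iset.
Qed.

Lemma iexp_avoids_nil e : iexp_avoids [::] e.
Proof. by elim: e => //= e1 -> e2 ->. Qed.

Lemma iteri_ind (P : nat -> state R -> Prop) n f s :
  P 0%N s -> (forall k s', (k < n)%N -> P k s' -> P k.+1 (f k s')) ->
  P n (iteri n f s).
Proof.
elim: n => [//|n IH] P0 PS; rewrite /=; apply: (PS) => //.
by apply: IH => // k s' kn; apply: PS; exact: ltnW.
Qed.

Lemma compileP d e s (s' := exec (compile d e) s) :
  (tmp_base <= d)%N -> sexp_wf e ->
  [/\ smem s' d 0 0 = seval s e, agree (sum_regs e) s' s
    & forall a, (a < d)%N -> forall x y, smem s' a x y = smem s a x y].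
Proof.
rewrite {}/s'; elim: e d s => [l|n|e IH|o e1 IH1 e2 IH2|a b e IH] d s /= dT.
- by move=> _; split=> //= [|a ad x y]; rewrite ?eqxx // (ltn_eqF ad).
- by move=> _; split=> //= [|a ad x y]; rewrite ?eqxx // (ltn_eqF ad).
- move=> we; have [v1 v2 v3] := IH d s dT we; split=> //=.
    by rewrite /sget /= !eqxx v1.
  by move=> a ad x y; rewrite (ltn_eqF ad) /= v3.
- case/and3P=> w1 w2 o12; have [v1 v2 v3] := IH1 d s dT w1.
  set s1 := exec _ s in v1 v2 v3 *.
  have [u1 u2 u3] := IH2 d.+1 s1 (leqW dT) w2.
  set s2 := exec _ s1 in u1 u2 u3 *; split=> /=.
  + rewrite /sget /= !eqxx u1 u3 // v1; congr aeval.
    apply: seval_agree v2 _ o12 => a aT x y; apply: v3.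
    exact: leq_trans aT dT.
  + suff h : agree (sum_regs e1 ++ sum_regs e2) s2 s by exact: h.
    apply: (@agree_trans _ _ s1).
      by apply: agree_sub u2 _ => x; rewrite mem_cat orbC => ->.
    by apply: agree_sub v2 _ => x; rewrite mem_cat => ->.
  + move=> a ad x y; rewrite (ltn_eqF ad) /= u3 ?v3 //; exact: leqW.
- case/andP=> we oe.
  set s0 := tick _; have es0 : ieval s0 b = ieval s b.
    by apply: (@ieval_agree [::]) => //; exact: iexp_avoids_nil.
  rewrite es0; set f := fun _ _ => _.
  pose P n (s' : state R) := [/\ smem s' d 0 0 = \sum_(k < n) seval (iset s a 0 k) e,
    agree (a :: sum_regs e) s' s
    & forall a, (a < d)%N -> forall x y, smem s' a x y = smem s a x y].
  apply: (iteri_ind (P := P)).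
    split=> //=; first by rewrite !eqxx big_ord0.
    by move=> c cd x y; rewrite (ltn_eqF cd).
  move=> k s' _ [v1 v2 v3]; rewrite /f.
  have [u1 u2 u3] := IH d.+1 (iset s' a 0 k) (leqW dT) we.
  split=> /=.
  + rewrite /sget /= !eqxx u3 // u1 big_ord_recr /= v1; congr (_ + _).
    apply: (@seval_agree (sum_regs e)) oe => [|c cT x y /=]; last first.
      by rewrite v3 //; exact: leq_trans cT dT.
    apply: agree_sub (@agree_iset _ a k _ _ v2) _ => x.
    by rewrite mem_filter inE; case: eqP.
  + set s1 := exec _ _ in u1 u2 u3 *.
    suff h : agree (a :: sum_regs e) s1 s by exact: h.
    apply: (@agree_trans _ _ (iset s' a 0 k)).
      by apply: agree_sub u2 _ => x; rewrite inE orbC => ->.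
    apply: agree_trans v2; apply: agree_sub (@agree_iset_self _ _ _) _ => x.
    by rewrite !inE => ->.
  + by move=> c cd x y; rewrite (ltn_eqF cd) /= u3 ?v3 //; exact: leqW.
Qed.

Lemma fillP a row0 ei ej i j e s (s' := exec (fill a row0 ei ej i j e) s) x y :
  fill_wf a row0 ej i j e ->
  smem s' a x y =
  if [&& ieval s row0 <= x, x < ieval s row0 + ieval s ei & y < ieval s ej]%N
  then seval (iset (iset s i 0 (x - ieval s row0)) j 0 y) e else smem s a x y.
Proof.
case/and5P=> /= /andP[]; rewrite inE => ij _ ie je or /and4P[oj aT we oe].
set L := [:: i, j & sum_regs e] in or oj *.
set b := ieval s row0; set n := ieval s ej; rewrite {}/s' /fill /=.
have sL : forall l, l \in sum_regs e -> l \in L by move=> l; rewrite !inE => ->; rewrite !orbT.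
pose val x y := seval (iset (iset s i 0 (x - b)) j 0 y) e.
pose ok (s' : state R) := agree L s' s /\
  forall c, (c < tmp_base)%N && (c != a) -> forall x y, smem s' c x y = smem s c x y.
pose P m (s' : state R) := ok s' /\ forall x y, smem s' a x y =
  if [&& b <= x, x < b + m & y < n]%N then val x y else smem s a x y.
suff [_ ->] : P (ieval s ei) (exec (fill a row0 ei ej i j e) s) by [].
rewrite /fill /=; apply: (iteri_ind (P := P)).
  split=> // u v; rewrite addn0; case: ifP => // /and3P[bu ub]; lia.
move=> k s1 km [ok1 v1].
have ok1' : ok (iset s1 i 0 k).
  split=> [|c /ok1.2 //]; apply: agree_trans ok1.1.
  by apply: agree_sub (@agree_iset_self _ _ _) _ => u; rewrite !inE => ->.
rewrite (ieval_agree ok1'.1 oj).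
(* State in the middle of row k: m entries of row b + k are written, and the counter i still holds
   k, which the copy into [a] reads. *)
pose P' m (s' : state R) := [/\ ok s', imem s' i 0 = k & forall x y, smem s' a x y =
  if [&& b <= x, x < b + k & y < n]%N || (x == b + k)%N && (y < m)%N
  then val x y else smem s a x y].
set s2 := iteri _ _ _.
have [ok2 i2 v2] : P' n s2.
  apply: (iteri_ind (P := P')).
    split=> //=; first by rewrite !eqxx.
    by move=> u v; rewrite v1 ltn0 andbF orbF.
  move=> l s3 ln [ok3 i3 v3].
  have [u1 u2 u3] := @compileP tmp_base e (iset s3 j 0 l) (leqnn _) we.
  set s4 := exec _ _ in u1 u2 u3 *.
  have ok4 : ok s4.
    split=> [|c /andP[cT ca] u v].
      apply: (@agree_trans _ _ (iset s3 j 0 l)); first exact: agree_sub u2 _.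
      apply: agree_trans ok3.1.
      by apply: agree_sub (@agree_iset_self _ _ _) _ => u; rewrite !inE => ->; rewrite orbT.
    by rewrite u3 //= ok3.2 // cT ca.
  have i4 : imem s4 i 0 = k by rewrite u2 ?ie ?orbT //= (negPf ij).
  have j4 : imem s4 j 0 = l by rewrite u2 ?je ?orbT //= !eqxx.
  have b4 : ieval s4 row0 = b by apply: ieval_agree ok4.1 or.
  split=> /=.
  + by split=> [|c /andP[cT ca] u v] /=; [exact: ok4.1 | rewrite (negPf ca) /= ok4.2 ?cT].
  + exact: i4.
  + move=> u v; rewrite eqxx /= b4 i4 j4 /sget /= u1.
    case: (eqVneq u (b + k)%N) => [->|ubk] /=; last first.
      by rewrite u3 //= v3 (negPf ubk).
    case: (eqVneq v l) => [->|vl] /=; last first.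
      by rewrite u3 //= v3 eqxx /=; congr (if _ then _ else _); lia.
    rewrite ltnSn orbT /val addKn; apply: seval_agree oe.
      move=> c q /=; case: (eqVneq q 0%N) => [->|q0] /=; last first.
        by rewrite !andbF => _; apply: ok3.1; rewrite q0.
      rewrite !andbT => cr; case: ifP => // /negbT cj.
      case: (eqVneq c i) => [->|ci]; first exact: i3.
      by apply: ok3.1; rewrite !inE (negPf ci) (negPf cj) (negPf cr) orbT.
    by move=> c cc q w /=; rewrite ok3.2.
split=> // u v; rewrite v2; congr (if _ then _ else _); lia.
Qed.

(** * Frame rules and an upper bound on the operation count *)

Lemma frame_int c s a l : a \notin writes_int c -> imem (exec c s) a l = imem s a l.
Proof.
elim: c s => [|b e v|d n|d x|d x|o d x y|c1 IH1 c2 IH2|e1 e2 c1 IH1 c2 IH2|x y c1 IH1 c2 IH2|b e c IH] s //=.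
- by rewrite inE => /negPf->.
- by rewrite mem_cat negb_or => /andP[a1 a2]; rewrite IH2 ?IH1.
- by rewrite mem_cat negb_or => /andP[a1 a2]; case: ifP => _; rewrite ?IH2 ?IH1.
- by rewrite mem_cat negb_or => /andP[a1 a2]; case: ifP => _; rewrite ?IH2 ?IH1.
- rewrite inE negb_or => /andP[ab ac].
  apply: (@iteri_ind (fun _ s' => imem s' a l = imem s a l)) => // k s' _ <-.
  by rewrite IH //= (negPf ab).
Qed.

Lemma frame_regs (L : seq nat) c s a l :
  all [in L] (writes_int c) -> a \notin L -> imem (exec c s) a l = imem s a l.
Proof. by move=> /allP cL aL; apply: frame_int; apply: contra aL => /cL. Qed.

Lemma frame_sc c s a x y : a \notin writes_sc c -> smem (exec c s) a x y = smem s a x y.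
Proof.
elim: c s => [|b e v|d n|d z|d z|o d z t|c1 IH1 c2 IH2|e1 e2 c1 IH1 c2 IH2|z t c1 IH1 c2 IH2|b e c IH] s //=;
  rewrite ?inE.
- by move=> /negPf->.
- by move=> /negPf->.
- by move=> /negPf->.
- by move=> /negPf->.
- by rewrite mem_cat negb_or => /andP[a1 a2]; rewrite IH2 ?IH1.
- by rewrite mem_cat negb_or => /andP[a1 a2]; case: ifP => _; rewrite ?IH2 ?IH1.
- by rewrite mem_cat negb_or => /andP[a1 a2]; case: ifP => _; rewrite ?IH2 ?IH1.
- move=> ac; apply: (@iteri_ind (fun _ s' => smem s' a x y = smem s a x y)) => // k s' _ <-.
  by rewrite IH.
Qed.

Fixpoint cost s (c : cmd) : nat :=
  match c with
  | CSkip | CISet _ _ _ => 0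
  | CConst _ _ | CCopy _ _ | CConj _ _ | CArith _ _ _ _ => 1
  | CSeq c1 c2 => cost s c1 + cost s c2
  | CIfI _ _ c1 c2 => maxn (cost s c1) (cost s c2)
  | CIfS _ _ c1 c2 => (maxn (cost s c1) (cost s c2)).+1
  | CFor _ e c1 => ieval s e * cost s c1
  end.

(** Loop bounds read no register that [c] writes, so they keep the values they have in [s], where
    [cost] evaluates them. The induction lets the current state differ from [s] on a fixed set L
    containing the written registers. *)
Lemma ops_le_cost c s :
  bounds_avoid (writes_int c) c -> (ops (exec c s) <= ops s + cost s c)%N.
Proof.
suff gen (L : seq nat) c0 s' : (forall a l, a \notin L -> imem s' a l = imem s a l) ->
    bounds_avoid L c0 -> {subset writes_int c0 <= L} ->
    (ops (exec c0 s') <= ops s' + cost s c0)%N.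
  by move=> bc; exact: (gen (writes_int c)).
have ie s1 e : (forall a l, a \notin L -> imem s1 a l = imem s a l) ->
    iexp_avoids L e -> ieval s1 e = ieval s e.
  move=> h; elim: e => //= [a e IH /andP[aL /IH->]|e1 IH1 e2 IH2 /andP[/IH1-> /IH2->]
    |e1 IH1 e2 IH2 /andP[/IH1-> /IH2->]|e1 IH1 e2 IH2 /andP[/IH1-> /IH2->]] //; exact: h.
elim: c0 s' => [|b e v|d n|d z|d z|o d z t|c1 IH1 c2 IH2|e1 e2 c1 IH1 c2 IH2|z t c1 IH1 c2 IH2|b e c1 IH] s' hs /=;
  rewrite ?addn0 ?addn1 //.
- move=> /andP[b1 b2] sub.
  have sub1 : {subset writes_int c1 <= L} by move=> x x1; apply: sub; rewrite mem_cat x1.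
  have sub2 : {subset writes_int c2 <= L} by move=> x x1; apply: sub; rewrite mem_cat x1 orbT.
  have h1 a l : a \notin L -> imem (exec c1 s') a l = imem s a l.
    by move=> aL; rewrite frame_int ?hs // (contra (@sub1 a)).
  have := IH1 s' hs b1 sub1; have := IH2 _ h1 b2 sub2; lia.
- move=> /andP[b1 b2] sub.
  have sub1 : {subset writes_int c1 <= L} by move=> x x1; apply: sub; rewrite mem_cat x1.
  have sub2 : {subset writes_int c2 <= L} by move=> x x1; apply: sub; rewrite mem_cat x1 orbT.
  have := IH1 s' hs b1 sub1; have := IH2 _ hs b2 sub2; case: ifP => _; lia.
- move=> /andP[b1 b2] sub.
  have sub1 : {subset writes_int c1 <= L} by move=> x x1; apply: sub; rewrite mem_cat x1.
  have sub2 : {subset writes_int c2 <= L} by move=> x x1; apply: sub; rewrite mem_cat x1 orbT.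
  have := IH1 (tick s') hs b1 sub1; have := IH2 (tick s') hs b2 sub2; case: ifP => _ /=; lia.
- move=> /andP[be bc1] sub; rewrite (ie _ _ hs be).
  have sub1 : {subset writes_int c1 <= L} by move=> x x1; apply: sub; rewrite inE x1 orbT.
  have bL : b \in L by apply: sub; rewrite mem_head.
  set P := fun k (s1 : state R) => (ops s1 <= ops s' + k * cost s c1)%N /\
     forall a l, a \notin L -> imem s1 a l = imem s a l.
  suff [] : P (ieval s e) (iteri (ieval s e) (fun k s1 => exec c1 (iset s1 b 0 k)) s') by [].
  apply: (iteri_ind (P := P)); first by split=> //; rewrite addn0.
  move=> k s1 _ [o1 h1].
  have h1' a l : a \notin L -> imem (iset s1 b 0 k) a l = imem s a l.
    move=> aL /=; case: eqVneq => [ab|_] /=; last exact: h1.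
    by rewrite ab bL in aL.
  split; first by have := IH _ h1' bc1 sub1 => /=; lia.
  by move=> a l aL; rewrite frame_int ?h1' // (contra (@sub1 a)).
Qed.

End Execution.

Arguments exec : simpl never.

(** * Squared Frobenius norm, operator bounds and orthogonal projectors *)

Section FrobeniusSquared.
Variable R : realType.
Notation C := R[i].
Implicit Types m n k : nat.

(** [frob_norm A] unfolds to [Num.sqrt (fsq A)]. All estimates are made on these squares, which
    [fsqE] turns into traces. *)
Definition fsq m n (A : 'M[C]_(m, n)) : R :=
  \sum_i \sum_j ComplexField.Normc.normc (A i j) ^+ 2.

Lemma normc_sqE (z : C) : (ComplexField.Normc.normc z ^+ 2)%:C = z * Num.conj z.
Proof. by rewrite -normCK rmorphXn. Qed.

Lemma normc_ge0 (z : C) : 0 <= ComplexField.Normc.normc z.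
Proof. by case: z => a b; rewrite /ComplexField.Normc.normc sqrtr_ge0. Qed.

Lemma fsqE m n (A : 'M[C]_(m, n)) : (fsq A)%:C = \tr (A *m ctrmx A).
Proof.
rewrite /fsq /mxtrace rmorph_sum; apply: eq_bigr => i _.
rewrite mxE rmorph_sum; apply: eq_bigr => j _.
by rewrite !mxE; exact: normc_sqE.
Qed.

Lemma fsq_ge0 m n (A : 'M[C]_(m, n)) : 0 <= fsq A.
Proof. by apply: sumr_ge0 => i _; apply: sumr_ge0 => j _; rewrite exprn_ge0 ?normc_ge0. Qed.

Lemma conj_real (x : R) : Num.conj (x%:C) = x%:C.
Proof. exact: conjc_real. Qed.

Lemma ctrmxE m n (A : 'M[C]_(m, n)) i j : ctrmx A i j = Num.conj (A j i).
Proof. by rewrite !mxE. Qed.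

Lemma ctrmxD m n (A B : 'M[C]_(m, n)) : ctrmx (A + B) = ctrmx A + ctrmx B.
Proof. by rewrite /ctrmx linearD map_mxD. Qed.

Lemma ctrmxB m n (A B : 'M[C]_(m, n)) : ctrmx (A - B) = ctrmx A - ctrmx B.
Proof. by rewrite /ctrmx linearB map_mxB. Qed.

Lemma ctrmxZ m n (a : R) (A : 'M[C]_(m, n)) : ctrmx (a%:C *: A) = a%:C *: ctrmx A.
Proof. by apply/matrixP=> i j; rewrite !mxE rmorphM /= -[X in _ = X * _]conj_real. Qed.

Lemma ctrmx1 n : ctrmx (1%:M : 'M[C]_n) = 1%:M.
Proof. by rewrite /ctrmx trmx1 map_mx1. Qed.

Lemma ctrmx0 m n : ctrmx (0 : 'M[C]_(m, n)) = 0.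
Proof. by rewrite /ctrmx trmx0 map_mx0. Qed.

Lemma fsq_ctr m n (A : 'M[C]_(m, n)) : fsq (ctrmx A) = fsq A.
Proof. by apply: complexI; rewrite !fsqE ctrmxK mxtrace_mulC. Qed.

Lemma fsq_tr m n (A : 'M[C]_(m, n)) : fsq A^T = fsq A.
Proof. by rewrite /fsq exchange_big; do 2!apply: eq_bigr => ? _; rewrite mxE. Qed.

Lemma fsq_conj m n (A : 'M[C]_(m, n)) : fsq (map_mx Num.conj A) = fsq A.
Proof. by rewrite -fsq_ctr /ctrmx -map_trmx -map_mx_comp map_mx_id ?fsq_tr // => x /=; rewrite conjCK. Qed.

Lemma fsq_eq0 m n (A : 'M[C]_(m, n)) : fsq A = 0 -> A = 0.
Proof.
move=> /eqP; rewrite psumr_eq0 => [/allP A0|i _]; last first.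
  by apply: sumr_ge0 => j _; rewrite exprn_ge0 ?normc_ge0.
apply/matrixP=> i j; have /eqP := A0 i (mem_index_enum _).
move=> /eqP; rewrite psumr_eq0 => [/allP Ai0|k _]; last by rewrite exprn_ge0 ?normc_ge0.
have := Ai0 j (mem_index_enum _); rewrite /= expf_eq0 /= mxE => /eqP.
exact: ComplexField.Normc.eq0_normc.
Qed.

Lemma fsq0 m n : fsq (0 : 'M[C]_(m, n)) = 0.
Proof. by apply: complexI; rewrite fsqE mul0mx mxtrace0. Qed.

Lemma fsqZ m n (a : R) (A : 'M[C]_(m, n)) : fsq (a%:C *: A) = a ^+ 2 * fsq A.
Proof.
apply: complexI; rewrite fsqE ctrmxZ -scalemxAl -scalemxAr !linearZ /= -fsqE.
by rewrite expr2 -mulrA -!rmorphM.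
Qed.

Lemma fsq_add_orthor m n (A B : 'M[C]_(m, n)) :
  A *m ctrmx B = 0 -> fsq (A + B) = fsq A + fsq B.
Proof.
move=> AB; have BA : B *m ctrmx A = 0 by rewrite -[LHS]ctrmxK ctrmxM ctrmxK AB ctrmx0.
apply: complexI; rewrite [RHS]rmorphD /= !fsqE ctrmxD mulmxDl !mulmxDr AB BA.
by rewrite addr0 add0r linearD.
Qed.

Lemma fsq_add_orthol m n (A B : 'M[C]_(m, n)) :
  ctrmx A *m B = 0 -> fsq (A + B) = fsq A + fsq B.
Proof.
by move=> AB; rewrite -fsq_ctr ctrmxD fsq_add_orthor ?fsq_ctr // ctrmxK.
Qed.

Lemma fsq_col m n (A : 'M[C]_(m, n)) : fsq A = \sum_j fsq (col j A).
Proof.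
rewrite /fsq exchange_big; apply: eq_bigr => j _; apply: eq_bigr => i _.
by rewrite big_ord1 mxE.
Qed.

Lemma fsq_row m n (A : 'M[C]_(m, n)) : fsq A = \sum_i fsq (row i A).
Proof.
by rewrite /fsq; apply: eq_bigr => i _; rewrite big_ord1; apply: eq_bigr => j _; rewrite mxE.
Qed.

(* [sqbound A c] : the square of the operator norm of [A] is at most [c]. *)
Definition sqbound m n (A : 'M[C]_(m, n)) (c : R) : Prop :=
  0 <= c /\ forall x : 'cV[C]_n, fsq (A *m x) <= c * fsq x.

Lemma sqbound_mulmx m n k (A : 'M[C]_(m, n)) c (X : 'M[C]_(n, k)) :
  sqbound A c -> fsq (A *m X) <= c * fsq X.
Proof.
move=> [c0 Ac]; rewrite fsq_col [fsq X]fsq_col mulr_sumr; apply: ler_sum => j _.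
by rewrite !colE -mulmxA.
Qed.

Lemma sqbound_ctr m n (A : 'M[C]_(m, n)) c : sqbound A c -> sqbound (ctrmx A) c.
Proof.
move=> [c0 Ac]; split=> // y; set x := ctrmx A *m y.
have tr1 : \tr (A *m x *m ctrmx y) = (fsq x)%:C.
  by rewrite fsqE mxtrace_mulC mulmxA -(mxtrace_mulC x) /x ctrmxM ctrmxK.
have tr2 : \tr (y *m ctrmx (A *m x)) = (fsq x)%:C.
  by rewrite ctrmxM mulmxA -(mulmxA y) mxtrace_mulC fsqE -mulmxA -/x mxtrace_mulC.
have exp : fsq (A *m x - c%:C *: y) = fsq (A *m x) - 2 * c * fsq x + c ^+ 2 * fsq y.
  apply: complexI; rewrite fsqE ctrmxB ctrmxZ mulmxBl !mulmxBr.
  rewrite -!scalemxAl -!scalemxAr !raddfB /= !mxtraceZ tr1 tr2 -!fsqE.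
  rewrite expr2 !(rmorphD, rmorphN, rmorphM, rmorph1) /=; ring.
have := fsq_ge0 (A *m x - c%:C *: y); rewrite {}exp => h.
have := Ac x; have := fsq_ge0 x; have := fsq_ge0 y => y0 x0 h2.
have [cp|cn] := ltP 0 c.
  by rewrite -(ler_pM2l cp); nra.
have cz : c = 0 by lra.
rewrite cz mul0r in h2 *; rewrite le_eqVlt; apply/orP; left; apply/eqP.
apply: complexI; rewrite -tr1.
have /fsq_eq0 -> : fsq (A *m x) = 0 by have := fsq_ge0 (A *m x); lra.
by rewrite mul0mx mxtrace0 mul0r.
Qed.

Lemma sqbound_conj m n (A : 'M[C]_(m, n)) c : sqbound A c -> sqbound (map_mx Num.conj A) c.
Proof.
move=> [c0 Ac]; split=> // x; rewrite -fsq_conj map_mxM -map_mx_comp.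
rewrite (map_mx_id (f := _ \o _)) => [|z /=]; last by rewrite conjCK.
by rewrite (le_trans (Ac _)) // fsq_conj.
Qed.

Lemma sqbound_tr m n (A : 'M[C]_(m, n)) c : sqbound A c -> sqbound A^T c.
Proof.
move=> /sqbound_ctr /sqbound_conj; rewrite /ctrmx -map_mx_comp map_mx_id // => z /=.
by rewrite conjCK.
Qed.

Lemma sqbound_mulmxr m n k (A : 'M[C]_(m, n)) c (X : 'M[C]_(k, m)) :
  sqbound A c -> fsq (X *m A) <= c * fsq X.
Proof. by move=> /sqbound_ctr h; rewrite -fsq_ctr ctrmxM -(fsq_ctr X); exact: sqbound_mulmx. Qed.

Lemma sqbound_le m n (A : 'M[C]_(m, n)) c c' : c <= c' -> sqbound A c -> sqbound A c'.
Proof.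
move=> cc [c0 Ac]; split=> [|x]; first exact: le_trans cc.
by rewrite (le_trans (Ac x)) // ler_wpM2r ?fsq_ge0.
Qed.

(** A column acts on scalars, so its bound is immediate; passing to adjoints gives it for rows,
    which is the Cauchy-Schwarz inequality, and the rows of A are summed. *)
Lemma sqbound_fsq m n (A : 'M[C]_(m, n)) : sqbound A (fsq A).
Proof.
have colb k (u : 'cV[C]_k) : sqbound u (fsq u).
  split=> [|t]; first exact: fsq_ge0.
  rewrite [t]mx11_scalar mul_mx_scalar; set z := t 0 0.
  rewrite {3}/fsq big_ord1 big_ord1 mxE eqxx mulr1n mulr_suml /fsq.
  apply: ler_sum => i _; rewrite !big_ord1 mxE.
  by rewrite ComplexField.Normc.normcM exprMn mulrC.
split=> [|x]; first exact: fsq_ge0.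
rewrite fsq_row [fsq A]fsq_row mulr_suml; apply: ler_sum => i _.
rewrite row_mul -(fsq_ctr (row i A)) -[row i A in X in X <= _]ctrmxK.
by apply: sqbound_mulmx; apply: sqbound_ctr; exact: colb.
Qed.

Lemma sqbound_add_orthol m n (A B : 'M[C]_(m, n)) a b :
  ctrmx A *m B = 0 -> sqbound A a -> sqbound B b -> sqbound (A + B) (a + b).
Proof.
move=> AB [a0 Aa] [b0 Bb]; split=> [|x]; first exact: addr_ge0.
rewrite mulmxDl fsq_add_orthol; first by rewrite mulrDl lerD.
by rewrite ctrmxM mulmxA -(mulmxA _ _ B) AB mulmx0 mul0mx.
Qed.

Lemma sqbound_add_orthor m n (A B : 'M[C]_(m, n)) a b :
  A *m ctrmx B = 0 -> sqbound A a -> sqbound B b -> sqbound (A + B) (a + b).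
Proof.
move=> AB Aa Bb; rewrite -[A + B]ctrmxK ctrmxD; apply: sqbound_ctr.
by apply: sqbound_add_orthol; rewrite ?ctrmxK //; exact: sqbound_ctr.
Qed.

Definition orthoproj n (P : 'M[C]_n) : Prop := ctrmx P = P /\ P *m P = P.

Lemma orthoproj_compl n (P : 'M[C]_n) : orthoproj P -> orthoproj (1%:M - P).
Proof.
move=> [h i]; split; first by rewrite ctrmxB ctrmx1 h.
by rewrite mulmxBl mul1mx mulmxBr mulmx1 i subrr subr0.
Qed.

Lemma orthoproj_tr n (P : 'M[C]_n) : orthoproj P -> orthoproj P^T.
Proof.
move=> [h i]; split; last by rewrite -trmx_mul i.
by rewrite -{2}h /ctrmx trmxK map_trmx trmxK.
Qed.

Lemma fsq_orthoproj n (P : 'M[C]_n) : orthoproj P -> (fsq P)%:C = \tr P.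
Proof. by move=> [h i]; rewrite fsqE h i. Qed.

Lemma orthoproj_mulC n (P : 'M[C]_n) : orthoproj P -> P *m (1%:M - P) = 0.
Proof. by move=> [h i]; rewrite mulmxBr mulmx1 i subrr. Qed.

Lemma fsq_projr m n (A : 'M[C]_(m, n)) P :
  orthoproj P -> fsq A = fsq (A *m P) + fsq (A *m (1%:M - P)).
Proof.
move=> pP; rewrite -fsq_add_orthor; first by rewrite -mulmxDr addrC subrK mulmx1.
rewrite ctrmxM (orthoproj_compl pP).1 mulmxA -(mulmxA A) orthoproj_mulC //.
by rewrite mulmx0 mul0mx.
Qed.

Lemma fsq_projl m n (A : 'M[C]_(m, n)) P :
  orthoproj P -> fsq A = fsq (P *m A) + fsq ((1%:M - P) *m A).
Proof.
move=> pP; rewrite -(fsq_ctr (P *m A)) -(fsq_ctr ((1%:M - P) *m A)) !ctrmxM pP.1.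
by rewrite (orthoproj_compl pP).1 -fsq_projr // fsq_ctr.
Qed.

Lemma fsq_projl_le m n (A : 'M[C]_(m, n)) P : orthoproj P -> fsq (P *m A) <= fsq A.
Proof. by move=> pP; rewrite (fsq_projl A pP) lerDl fsq_ge0. Qed.

Lemma fsq_projr_le m n (A : 'M[C]_(m, n)) P : orthoproj P -> fsq (A *m P) <= fsq A.
Proof. by move=> pP; rewrite (fsq_projr A pP) lerDl fsq_ge0. Qed.

Lemma sqbound_projl m n (A : 'M[C]_(m, n)) P c :
  orthoproj P -> sqbound A c -> sqbound (P *m A) c.
Proof.
move=> pP [c0 Ac]; split=> // x; rewrite -mulmxA.
exact: le_trans (fsq_projl_le _ pP) (Ac x).
Qed.

Lemma sqbound_projr m n (A : 'M[C]_(m, n)) P c :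
  orthoproj P -> sqbound A c -> sqbound (A *m P) c.
Proof.
move=> pP [c0 Ac]; split=> // x; rewrite -mulmxA (le_trans (Ac _)) //.
by rewrite ler_wpM2l // fsq_projl_le.
Qed.

(** In a full-rank factorization P = L U, cancelling L and U in P P = P leaves U L = 1, of size rank
    P, and tr (L U) = tr (U L). *)
Lemma mxtrace_idem (F : fieldType) n (P : 'M[F]_n) : P *m P = P -> \tr P = (\rank P)%:R.
Proof.
move=> i; have UL : row_base P *m col_base P = 1%:M.
  apply: (row_full_inj (col_base_full P)); rewrite mulmx1.
  apply: (row_free_inj (row_base_free P)).
  by rewrite mulmxA -mulmxA -mulmxA mulmxA mulmx_base i.
by rewrite -{1}(mulmx_base P) mxtrace_mulC UL mxtrace1.
Qed.

Lemma orthoproj_rank n (P : 'M[C]_n) r : orthoproj P -> \tr P = r%:R -> \rank P = r.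
Proof. by move=> [_ /mxtrace_idem->] /eqP; rewrite eqr_nat => /eqP. Qed.

Lemma fsq_orthoprojN n (P : 'M[C]_n) r : orthoproj P -> \tr P = r%:R -> fsq P = r%:R.
Proof. by move=> pP tP; apply: complexI; rewrite fsq_orthoproj // tP rmorph_nat. Qed.

Lemma fsq_orthoproj_compl n (P : 'M[C]_n) r :
  orthoproj P -> \tr P = r%:R -> fsq (1%:M - P) = (n - r)%N%:R.
Proof.
move=> pP tP; apply: fsq_orthoprojN; first exact: orthoproj_compl.
rewrite linearB /= mxtrace1 tP natrB //.
by rewrite -(orthoproj_rank pP tP) rank_leq_row.
Qed.

End FrobeniusSquared.

(** * Greedy column selection *)

Section Pivoting.
Variable R : realType.
Notation C := R[i].
Implicit Types m n r t : nat.

(** The elimination as an operation on an arbitrary M, since it is applied to the projector, to the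
    residual and to the accumulated transformation alike. For a projector, [fsq (row j P)] is P_jj
    seen as a real number. *)
Definition pivot n (P : 'M[C]_n) (j : 'I_n) m (M : 'M[C]_(m, n)) : 'M[C]_(m, n) :=
  M - ((fsq (row j P))^-1)%:C *: (col j M *m row j P).

Lemma pivotE n (P : 'M[C]_n) j m (M : 'M[C]_(m, n)) a b :
  pivot P j M a b = M a b - ((fsq (row j P))^-1)%:C * (M a j * P j b).
Proof. by rewrite /pivot !mxE big_ord1 !mxE. Qed.

Lemma pivot_mul n (P : 'M[C]_n) j m k (A : 'M[C]_(k, m)) (M : 'M[C]_(m, n)) :
  pivot P j (A *m M) = A *m pivot P j M.
Proof. by rewrite /pivot mulmxBr -scalemxAr mulmxA !colE mulmxA. Qed.

Lemma pivot_mulr n (P : 'M[C]_n) j m (M : 'M[C]_(m, n)) (Q : 'M[C]_n) :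
  P *m Q = P -> M *m Q = M -> pivot P j M *m Q = pivot P j M.
Proof. by move=> PQ MQ; rewrite /pivot mulmxBl MQ -scalemxAl -mulmxA -row_mul PQ. Qed.

Lemma orthoproj_ctrE n (P : 'M[C]_n) j : orthoproj P -> ctrmx (row j P) = col j P.
Proof.
move=> [h _]; apply/matrixP=> i k; rewrite ctrmxE !mxE -{1}h ctrmxE conjCK //.
Qed.

Lemma orthoproj_diag n (P : 'M[C]_n) j : orthoproj P -> P j j = (fsq (row j P))%:C.
Proof.
move=> pP; rewrite fsqE orthoproj_ctrE // colE mulmxA -row_mul pP.2.
by rewrite /mxtrace big_ord1 -colE !mxE.
Qed.

Lemma orthoproj_diag_sum n (P : 'M[C]_n) k :
  orthoproj P -> \tr P = k%:R -> \sum_j fsq (row j P) = k%:R.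
Proof. by move=> pP tP; rewrite -fsq_row; exact: fsq_orthoprojN. Qed.

(** The inequality has no quotient because P_jj may vanish. If it failed at every j with P_jj > 0,
    the reverse inequality would hold weakly at all j, trivially where P_jj = 0, and strictly at
    some j because tr P > 0; summing gives k |E|^2 < k |E|^2. *)
Lemma pivot_exists n (P : 'M[C]_n) m (E : 'M[C]_(m, n)) k :
  orthoproj P -> \tr P = k%:R -> (0 < k)%N ->
  exists j, 0 < fsq (row j P) /\ fsq (col j E) * k%:R <= fsq (row j P) * fsq E.
Proof.
move=> pP tP k0; have dsum := orthoproj_diag_sum pP tP.
have kp : 0 < k%:R :> R by rewrite ltr0n.
apply: contrapT => /forallNP none.
have lt j : 0 < fsq (row j P) -> fsq (row j P) * fsq E < fsq (col j E) * k%:R.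
  by move=> d0; rewrite ltNge; apply/negP => le; apply: (none j).
have le j : fsq (row j P) * fsq E <= fsq (col j E) * k%:R.
  have := fsq_ge0 (row j P); rewrite le_eqVlt => /orP[/eqP<-|/lt/ltW//].
  by rewrite mul0r mulr_ge0 ?fsq_ge0 // ltW.
have [j d0] : exists j, 0 < fsq (row j P).
  apply: contrapT => /forallNP z; move: kp; rewrite -dsum.
  rewrite big1 ?ltxx // => j _; apply/eqP; rewrite eq_le fsq_ge0 andbT leNgt.
  by apply/negP/z.
have : \sum_j (fsq (row j P) * fsq E) < \sum_j (fsq (col j E) * k%:R).
  by rewrite (bigD1 j) //= [ltRHS](bigD1 j) //= ltr_leD ?lt // ler_sum.
by rewrite -!mulr_suml dsum -fsq_col mulrC ltxx.
Qed.

Lemma mulmx_sub_rank1 n k (D : 'M[C]_(k, n)) (P : 'M[C]_n) a (u : 'cV[C]_n) (v : 'rV[C]_n) :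
  D *m (P - a *: (u *m v)) = D *m P - a *: (D *m u *m v).
Proof. by rewrite mulmxBr -scalemxAr mulmxA. Qed.

Lemma pivot_row n (P : 'M[C]_n) j :
  orthoproj P -> 0 < fsq (row j P) -> row j (pivot P j P) = 0.
Proof.
move=> pP d0; rewrite rowE -pivot_mul -rowE /pivot [col j _]mx11_scalar !mxE.
rewrite orthoproj_diag // mul_scalar_mx scalerA.
by rewrite -rmorphM /= mulVf ?gt_eqF // scale1r subrr.
Qed.

Lemma pivot_orthoproj n (P : 'M[C]_n) j :
  orthoproj P -> 0 < fsq (row j P) -> orthoproj (pivot P j P).
Proof.
move=> pP d0; set Q := pivot P j P.
have Qh : ctrmx Q = Q.
  rewrite /Q /pivot ctrmxB ctrmxZ; congr (_ - _ *: _); first exact: pP.1.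
  by rewrite ctrmxM -[col j P]orthoproj_ctrE // ctrmxK.
have QP : Q *m P = Q by apply: pivot_mulr; exact: pP.2.
have PQ : P *m Q = Q by rewrite -pivot_mul pP.2.
have Qc : Q *m col j P = 0.
  by rewrite -orthoproj_ctrE // -{1}Qh -ctrmxM -row_mul PQ pivot_row // ctrmx0.
split=> //; have -> : Q *m Q = Q *m P - ((fsq (row j P))^-1)%:C *: (Q *m col j P *m row j P).
  exact: mulmx_sub_rank1.
by rewrite Qc mul0mx scaler0 subr0.
Qed.

Lemma pivot_tr n (P : 'M[C]_n) j k :
  orthoproj P -> 0 < fsq (row j P) -> \tr P = k.+1%:R -> \tr (pivot P j P) = k%:R.
Proof.
move=> pP d0 tP; rewrite /pivot raddfB /= mxtraceZ tP -orthoproj_ctrE // mxtrace_mulC.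
by rewrite -fsqE -rmorphM mulVf ?gt_eqF //= -natr1 addrK.
Qed.

(** The rows of the correction are multiples of row j of P, orthogonal to the rows of E because E P
    = 0: this is Pythagoras. For P_jj = 0 both extra terms vanish, as the inverse of 0 is 0. *)
Lemma fsq_pivot n (P : 'M[C]_n) j m (E : 'M[C]_(m, n)) :
  orthoproj P -> E *m P = 0 ->
  fsq (pivot P j E) = fsq E + (fsq (row j P))^-1 * fsq (col j E).
Proof.
move=> pP EP; set d := fsq (row j P).
rewrite /pivot -/d -scaleNr -rmorphN /= fsq_add_orthor; last first.
  rewrite ctrmxZ ctrmxM orthoproj_ctrE // -scalemxAr mulmxA [col j P]colE mulmxA EP.
  by rewrite !mul0mx scaler0.
rewrite fsqZ; congr (_ + _).
have -> : fsq (col j E *m row j P) = fsq (col j E) * d.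
  apply: complexI; rewrite fsqE ctrmxM mulmxA -(mulmxA (col j E)).
  rewrite [row j P *m _]mx11_scalar.
  have -> : (row j P *m ctrmx (row j P)) 0 0 = d%:C.
    by rewrite /d fsqE /mxtrace big_ord1.
  by rewrite mul_mx_scalar -scalemxAl mxtraceZ -fsqE -rmorphM mulrC.
have [->|d0] := eqVneq d 0; first by rewrite invr0 oppr0 expr0n /= !mul0r.
by field.
Qed.

(** T is the product of the eliminations done so far. It fixes the complement of P0, and its rows at
    unselected indices are those of the identity, so 1 - T lives on the selected rows. Step t
    multiplies |E|^2 by at most (r + 1 - t) / (r - t); the product telescopes to the bound stated
    here. *)
Definition greedy_inv r t n m (P0 : 'M[C]_n) (E0 : 'M[C]_(m, n))
    (f : nat -> nat) (P : 'M[C]_n) (E : 'M[C]_(m, n)) (T : 'M[C]_n) : Prop :=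
  [/\ orthoproj P, \tr P = (r - t)%N%:R, P *m P0 = P & E *m P = 0] /\
  [/\ P0 *m T = P, E0 *m T = E, T *m (1%:M - P0) = 1%:M - P0,
      forall i : 'I_n, (forall s, (s < t)%N -> f s != i) -> row i T = row i 1%:M
    & fsq E * (r.+1 - t)%N%:R <= r.+1%:R * fsq E0] /\
  ((forall s, (s < t)%N -> exists2 i : 'I_n, f s = i & P i i = 0) /\
   {in gtn t &, injective f}).

Lemma greedy_init r n m (P0 : 'M[C]_n) (E0 : 'M[C]_(m, n)) f :
  orthoproj P0 -> \tr P0 = r%:R -> E0 *m P0 = 0 -> greedy_inv r 0 P0 E0 f P0 E0 1%:M.
Proof.
move=> pP tP EP; split; first by split=> //; rewrite ?subn0 // pP.2.
split; first by split=> //; rewrite ?mulmx1 ?mul1mx ?subn0 // mulrC.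
by split.
Qed.

Lemma greedy_step r t n m (P0 : 'M[C]_n) (E0 : 'M[C]_(m, n)) (f f' : nat -> nat) P E T (j : 'I_n) :
  (t < r)%N -> greedy_inv r t P0 E0 f P E T ->
  0 < fsq (row j P) -> fsq (col j E) * (r - t)%N%:R <= fsq (row j P) * fsq E ->
  f' t = j -> (forall s, (s < t)%N -> f' s = f s) ->
  greedy_inv r t.+1 P0 E0 f' (pivot P j P) (pivot P j E) (pivot P j T).
Proof.
move=> tr [[pP tP PP0 EP] [[P0T E0T T1 Trow Efsq] [fP finj]]] d0 le f't f's.
have rt : (r - t = (r - t.+1).+1)%N by lia.
(* P_ii is the squared norm of row i, so selected indices have lost their whole row and column and
   keep P_ii = 0 from then on. *)
have diag0 i : P i i = 0 -> col i P = 0.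
  move=> Pii; rewrite -orthoproj_ctrE //; have := orthoproj_diag i pP; rewrite Pii.
  by move=> /esym /complexI /fsq_eq0 ->; rewrite ctrmx0.
split; first split.
- exact: pivot_orthoproj.
- by apply: pivot_tr; rewrite -?rt.
- exact: pivot_mulr.
- have EpP : E *m pivot P j P = 0 by rewrite -pivot_mul EP /pivot linear0 mul0mx scaler0 subr0.
  rewrite {1}/pivot mulmxBl EpP -scalemxAl -mulmxA -row_mul -pivot_mul pP.2.
  by rewrite pivot_row // mulmx0 scaler0 subr0.
split; first split.
- by rewrite -pivot_mul P0T.
- by rewrite -pivot_mul E0T.
- rewrite /pivot mulmxBl T1 -scalemxAl -mulmxA -row_mul mulmxBr mulmx1 PP0 subrr.
  by rewrite linear0 mulmx0 scaler0 subr0.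
- move=> i fi; have ij : i != j.
    by rewrite eq_sym -val_eqE /= -f't; apply: fi.
  have Ti : row i T = row i 1%:M.
    by apply: Trow => s st; rewrite -f's //; apply: fi; exact: leqW.
  rewrite /pivot linearB linearZ /= row_mul Ti.
  have -> : row i (col j T) = 0.
    apply/rowP=> k; rewrite !mxE; have /rowP/(_ j) := Ti; rewrite !mxE => ->.
    by rewrite (negPf ij).
  by rewrite mul0mx scaler0 subr0.
- rewrite fsq_pivot // mulrDl.
  have -> : (r.+1 - t.+1)%N%:R = (r - t)%N%:R :> R by rewrite subSS.
  apply: le_trans Efsq; rewrite (_ : r.+1 - t = (r - t).+1)%N; last by lia.
  rewrite -natr1 mulrDr mulr1 lerD2l -mulrA ler_pdivrMl //.
split.
- move=> s; rewrite ltnS leq_eqVlt => /orP[/eqP->|st].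
    exists j => //; rewrite !mxE big_ord1 !mxE orthoproj_diag // mulrA -rmorphM /=.
    by rewrite mulVf ?gt_eqF // mul1r subrr.
  have [i fi Pi] := fP s st; exists i; first by rewrite f's.
  rewrite !mxE Pi big_ord1 !mxE; have /colP/(_ j) := diag0 i Pi.
  by rewrite !mxE => Pji; rewrite Pji mulr0 mulr0 subrr.
(* Earlier indices have a zero diagonal entry, the new one a positive entry. *)
- have neq s : (s < t)%N -> f' s != f' t.
    move=> st; rewrite f's // f't; have [i -> Pi] := fP s st.
    apply/eqP => /val_inj ij; move: d0; rewrite -(ltcR 0) -orthoproj_diag // -ij Pi.
    by rewrite ltxx.
  move=> s s'; rewrite !inE ltnS [(s' < _)%N]ltnS [(s <= t)%N]leq_eqVlt [(s' <= t)%N]leq_eqVlt.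
  case/orP=> [/eqP->|st]; case/orP=> [/eqP->|st'] //.
  + by move=> e; have := neq _ st'; rewrite e eqxx.
  + by move=> e; have := neq _ st; rewrite e eqxx.
  + by rewrite !f's //; apply: finj; rewrite inE.
Qed.

(** The second clause, applied to the rows R, will give R = Ahat Y and so bring in Ahat^-1. The
    third says that the error differs from B (1 - P) only inside P, which is what keeps the spectral
    bound small. *)
Definition selection_spec r m n (P : 'M[C]_n) (B : 'M[C]_(m, n))
    (J : 'I_r -> 'I_n) (Y : 'M[C]_(r, n)) : Prop :=
  [/\ injective J,
      forall k (D : 'M[C]_(k, n)), D *m P = D -> D = colsub J D *m Y,
      (B - colsub J B *m Y) *m (1%:M - P) = B *m (1%:M - P)
    & fsq (B - colsub J B *m Y) <= r.+1%:R * fsq (B *m (1%:M - P))].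

Lemma greedy_end r n m (P0 : 'M[C]_n) (B : 'M[C]_(m, n)) f P E T :
  orthoproj P0 ->
  greedy_inv r r P0 (B *m (1%:M - P0)) f P E T ->
  exists (J : 'I_r -> 'I_n) (Y : 'M[C]_(r, n)),
    (forall k : 'I_r, f k = J k) /\ selection_spec P0 B J Y.
Proof.
move=> pP0 [[pP tP _ _] [[P0T E0T T1 Trow Efsq] [fP finj]]].
have Pz : P = 0.
  by apply: fsq_eq0; rewrite (fsq_orthoprojN pP tP) subnn.
have Jex (k : 'I_r) : exists i : 'I_n, f k = i.
  by have [i fi _] := fP k (ltn_ord k); exists i.
pose J k := projT1 (cid (Jex k)).
have fJ (k : 'I_r) : f k = J k := projT2 (cid (Jex k)).
pose Y : 'M[C]_(r, n) := \matrix_(k < r) row (J k) (1%:M - T).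
have Jinj : injective J.
  move=> k k' e; apply/val_inj/finj; rewrite ?inE //=.
  by rewrite !fJ e.
(* Unselected rows of 1 - T vanish, so D (1 - T) involves only the selected columns of D. *)
have TE k (D : 'M[C]_(k, n)) : D - colsub J D *m Y = D *m T.
  suff -> : colsub J D *m Y = D *m (1%:M - T) by rewrite mulmxBr mulmx1 opprB addrC subrK.
  apply/matrixP=> a b; rewrite !mxE.
  rewrite [RHS](bigID (mem (J @: finset.setTfor 'I_r))) /= [X in _ = _ + X]big1 => [|i iJ]; last first.
    have Ti : row i T = row i 1%:M.
      apply: Trow => s sr; rewrite (fJ (Ordinal sr)); apply/negP=> /eqP/val_inj e.
      by case/negP: iJ; rewrite -e; apply: imset_f; rewrite finset.in_setT.
    by have /rowP/(_ b) := Ti; rewrite !mxE => ->; rewrite subrr mulr0.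
  rewrite addr0 big_imset /=; last by move=> ? ? _ _; exact: Jinj.
  by apply: eq_big => [i|i _]; rewrite ?finset.in_setT // !mxE.
have BT : B *m T = B *m (1%:M - P0) *m T.
  by rewrite -mulmxA mulmxBl mul1mx P0T Pz subr0.
exists J, Y; split=> //; split=> //.
- move=> k D DP; apply/eqP; rewrite -subr_eq0 TE -DP -mulmxA P0T Pz mulmx0 //.
- by rewrite TE -mulmxA T1.
- rewrite TE BT E0T; move: Efsq; rewrite subSnn mulr1 //.
Qed.

(** One Gram-Schmidt step without normalization. The last clause tracks the row space, needed to
    know when P is spanned by rows of A alone. *)
Lemma orthoproj_extend n (P : 'M[C]_n) (x : 'rV[C]_n) (y := x *m (1%:M - P)) c
    (P' := P + ((fsq y)^-1)%:C *: (ctrmx y *m y)) :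
  orthoproj P -> \tr P = c%:R -> y != 0 ->
  [/\ orthoproj P', \tr P' = c.+1%:R, x *m P' = x,
      forall u : 'rV[C]_n, u *m P = u -> u *m P' = u
    & forall k (V : 'M[C]_(k, n)), (P <= V)%MS -> (x <= V)%MS -> (P' <= V)%MS].
Proof.
move=> pP tP y0; set d := fsq y.
have d0 : d != 0 by apply: contra_neq y0 => /fsq_eq0.
have yP : y *m P = 0 by rewrite -mulmxA mulmxBl mul1mx pP.2 subrr mulmx0.
have Py : P *m ctrmx y = 0 by rewrite -{1}pP.1 -ctrmxM yP ctrmx0.
have yy : y *m ctrmx y = d%:C%:M.
  by rewrite [LHS]mx11_scalar /d fsqE /mxtrace big_ord1.
have yW : y *m P' = y.
  rewrite /P' mulmxDr yP add0r -scalemxAr mulmxA yy mul_scalar_mx scalerA -rmorphM /=.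
  by rewrite mulVf // scale1r.
have PW : P *m P' = P.
  by rewrite /P' mulmxDr pP.2 -scalemxAr mulmxA Py mul0mx scaler0 addr0.
have xE : x = x *m P + y by rewrite /y mulmxBr mulmx1 addrC subrK.
split.
- split; first by rewrite /P' ctrmxD pP.1 ctrmxZ ctrmxM ctrmxK.
  rewrite {1}/P' mulmxDl PW -scalemxAl -mulmxA yW //.
- rewrite /P' mxtraceD tP mxtraceZ mxtrace_mulC -fsqE -rmorphM /= mulVf //.
  by rewrite natr1.
- by rewrite {1}xE mulmxDl -mulmxA PW yW -xE.
- by move=> u uP; rewrite -uP -mulmxA PW.
- move=> k V PV xV; rewrite /P' addmx_sub // scalemx_sub // mulmx_sub //.
  by rewrite /y mulmxBr mulmx1 addmx_sub // eqmx_opp mulmx_sub.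
Qed.

End Pivoting.

(** * Error bounds of the cross approximations *)

Section CrossApproximation.
Variable R : realType.
Notation C := R[i].
Implicit Types m n r M N : nat.

(** * From bounds on squares to the norms *)

Lemma frob_norm_le m n m' n' (X : 'M[C]_(m, n)) (Y : 'M[C]_(m', n')) (a : R) :
  0 <= a -> fsq X <= a * fsq Y -> frob_norm X <= Num.sqrt a * frob_norm Y.
Proof.
move=> a0 XY; rewrite /frob_norm -sqrtrM //.
by rewrite ler_wsqrtr.
Qed.

Lemma frob_norm_sq m n (X : 'M[C]_(m, n)) : frob_norm X ^+ 2 = fsq X.
Proof. by rewrite sqr_sqrtr // fsq_ge0. Qed.

Lemma frob_norm_ge0 m n (X : 'M[C]_(m, n)) : 0 <= frob_norm X.
Proof. exact: sqrtr_ge0. Qed.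

Lemma frob_norm0 m n : frob_norm (0 : 'M[C]_(m, n)) = 0.
Proof. by rewrite -[LHS]/(Num.sqrt (fsq _)) fsq0 sqrtr0. Qed.

Lemma frob_normZ m n (a : R) (X : 'M[C]_(m, n)) :
  0 <= a -> frob_norm (a%:C *: X) = a * frob_norm X.
Proof.
move=> a0; rewrite -[LHS]/(Num.sqrt (fsq _)) fsqZ sqrtrM ?sqr_ge0 //.
by rewrite sqrtr_sqr ger0_norm.
Qed.

(** The supremum is meaningful because [frob_norm A] bounds the set. *)
Lemma spectral_norm_ub m n (A : 'M[C]_(m, n)) (x : 'cV[C]_n) :
  frob_norm x <= 1 -> frob_norm (A *m x) <= spectral_norm A.
Proof.
move=> x1; apply: sup_upper_bound; last by exists x.
split; first by exists (frob_norm (A *m x)), x.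
exists (frob_norm A) => _ [y y1 <-]; have [_ Ay] := sqbound_fsq A.
rewrite -(@ler_pXn2r _ 2) ?nnegrE ?frob_norm_ge0 // !frob_norm_sq (le_trans (Ay y)) //.
rewrite ler_piMr ?fsq_ge0 // -frob_norm_sq expr_le1 ?frob_norm_ge0 //.
Qed.

Lemma spectral_norm_ge0 m n (A : 'M[C]_(m, n)) : 0 <= spectral_norm A.
Proof.
apply: (le_trans (frob_norm_ge0 (A *m 0))); apply: spectral_norm_ub.
by rewrite frob_norm0 ler01.
Qed.

Lemma sqbound_spectral m n (A : 'M[C]_(m, n)) : sqbound A (spectral_norm A ^+ 2).
Proof.
split=> [|x]; first by rewrite exprn_ge0 // spectral_norm_ge0.
have := frob_norm_ge0 x; rewrite le_eqVlt => /orP[/eqP x0|x0].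
  have /fsq_eq0 -> : fsq x = 0 by rewrite -frob_norm_sq -x0 expr0n.
  by rewrite mulmx0 !fsq0 mulr0.
have := @spectral_norm_ub _ _ A (((frob_norm x)^-1)%:C *: x).
rewrite -scalemxAr !frob_normZ ?invr_ge0 ?frob_norm_ge0 // mulVf ?gt_eqF // => /(_ (lexx _)).
rewrite ler_pdivrMl // => h.
rewrite -!frob_norm_sq -exprMn ler_pXn2r ?nnegrE ?frob_norm_ge0 ?mulr_ge0 ?spectral_norm_ge0 ?frob_norm_ge0 //.
by rewrite mulrC.
Qed.

Lemma spectral_norm_le m n (A : 'M[C]_(m, n)) c : sqbound A c -> spectral_norm A <= Num.sqrt c.
Proof.
move=> [c0 Ac]; apply: ge_sup; first by exists (frob_norm (A *m (0 : 'cV_n))), 0; rewrite //= frob_norm0 ler01.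
move=> _ [x x1 <-]; rewrite -(@ler_pXn2r _ 2) ?nnegrE ?frob_norm_ge0 ?sqrtr_ge0 //.
rewrite frob_norm_sq sqr_sqrtr // (le_trans (Ac x)) // ler_piMr // -frob_norm_sq.
by rewrite expr_le1 ?frob_norm_ge0.
Qed.

(** Taking c to be the squared spectral norm of Y; elsewhere c stays universally quantified, which
    keeps suprema out of the linear algebra. *)
Lemma spectral_norm_le_mul m n m' n' (X : 'M[C]_(m, n)) (Y : 'M[C]_(m', n')) (a : R) :
  0 <= a -> (forall c, sqbound Y c -> sqbound X (a * c)) ->
  spectral_norm X <= Num.sqrt a * spectral_norm Y.
Proof.
move=> a0 /(_ _ (sqbound_spectral Y)) /spectral_norm_le.
by rewrite sqrtrM // sqrtr_sqr ger0_norm ?spectral_norm_ge0.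
Qed.

(** Split the error F as F (1 - P) + F P. The first part is B (1 - P), bounded by b; the second has
    |F P|_F^2 = |F|_F^2 - |B (1 - P)|_F^2 <= r |B (1 - P)|_F^2. So the Frobenius norm enters with
    factor r, not r + 1. *)
Lemma selection_bound r m n (P : 'M[C]_n) (B : 'M[C]_(m, n)) J (Y : 'M[C]_(r, n)) b q :
  orthoproj P -> selection_spec P B J Y ->
  sqbound (B *m (1%:M - P)) b -> fsq (B *m (1%:M - P)) <= q ->
  sqbound (B - colsub J B *m Y) (b + r%:R * q).
Proof.
move=> pP [_ _ F1 Fsq] Bb Bq; set F := B - _ in F1 Fsq *.
have -> : F = F *m (1%:M - P) + F *m P by rewrite -mulmxDr subrK mulmx1.
apply: sqbound_add_orthor; last 1 first.
- apply: sqbound_le (sqbound_fsq _).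
  have := fsq_projr F pP; rewrite F1 => h; have r0 : 0 <= r%:R :> R by [].
  have : fsq (F *m P) <= r%:R * fsq (B *m (1%:M - P)).
    by move: Fsq; rewrite -natr1 mulrDl mul1r h lerD2r.
  by move/le_trans; apply; rewrite ler_wpM2l.
- have z : (1%:M - P) *m P = 0 by rewrite mulmxBl mul1mx pP.2 subrr.
  by rewrite ctrmxM pP.1 mulmxA -(mulmxA F) z mulmx0 mul0mx.
- by rewrite F1.
Qed.

(** Pi B P = Pi B means B (1 - P) = (1 - Pi) B (1 - P). The outer projectors have squared Frobenius
    norms m - r and n - r, and either may be used: hence the minimum. *)
Lemma residual_bounds r m n (Pi : 'M[C]_m) (P : 'M[C]_n) (B : 'M[C]_(m, n)) b :
  orthoproj Pi -> \tr Pi = r%:R -> orthoproj P -> \tr P = r%:R ->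
  Pi *m B *m P = Pi *m B -> sqbound ((1%:M - Pi) *m B) b ->
  [/\ sqbound (B *m (1%:M - P)) b,
      fsq (B *m (1%:M - P)) <= fsq ((1%:M - Pi) *m B)
    & fsq (B *m (1%:M - P)) <= (minn m n - r)%N%:R * b].
Proof.
move=> pPi tPi pP tP PBP Bb; have qPi := orthoproj_compl pPi; have qP := orthoproj_compl pP.
have E : B *m (1%:M - P) = (1%:M - Pi) *m (B *m (1%:M - P)).
  have z : Pi *m (B *m (1%:M - P)) = 0 by rewrite mulmxA mulmxBr mulmx1 PBP subrr.
  by rewrite [RHS]mulmxBl mul1mx z subr0.
have E' : B *m (1%:M - P) = (1%:M - Pi) *m B *m (1%:M - P) by rewrite {1}E mulmxA.
have Eb : sqbound (B *m (1%:M - P)) b by rewrite E'; exact: sqbound_projr.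
split=> //; first by rewrite E' fsq_projr_le.
rewrite /minn mulrC; case: ltnP => _.
  rewrite E -(fsq_orthoproj_compl pPi tPi); exact: sqbound_mulmxr.
rewrite E' -(fsq_orthoproj_compl pP tP); exact: sqbound_mulmx.
Qed.

(* [W] (at most [r] rows) is captured by [P], which is completed by rows of [B]
   as long as there are enough of them. *)
Definition phase_spec r m n (W : 'M[C]_(r, n)) (B : 'M[C]_(m, n)) (P : 'M[C]_n)
    (Q : 'M[C]_(r, n)) (J : 'I_r -> 'I_n) (Y : 'M[C]_(r, n)) : Prop :=
  [/\ orthoproj P, \tr P = r%:R, W *m P = W,
      (W <= B)%MS -> (r <= \rank B)%N -> (P <= B)%MS
    & (exists G, P^T = G *m map_mx Num.conj Q) /\ selection_spec P B J Y].

(** This is how phases are chained within the budget: the next projector only has to capture the r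
    rows of conj(Q) B rather than the n rows of P^T B. *)
Lemma phase_link r m n m' (W Q : 'M[C]_(r, n)) (A : 'M[C]_(m, n)) (B : 'M[C]_(n, m')) P J Y
    (P' : 'M[C]_m') :
  phase_spec W A P Q J Y -> map_mx Num.conj Q *m B *m P' = map_mx Num.conj Q *m B ->
  P^T *m B *m P' = P^T *m B.
Proof. by move=> [_ _ _ _ [[G ->] _]] e; rewrite -!mulmxA (mulmxA _ B) e. Qed.

Lemma cross_approximation M N r (A Z : 'M[C]_(M, N))
    (PA : 'M[C]_M) QA JA YA (PB : 'M[C]_N) QB J YB (PC : 'M[C]_M) QC I YC
    (PD : 'M[C]_N) QD J' YD :
  \rank Z = r ->
  phase_spec (0 : 'M[C]_(r, M)) Z^T PA QA JA YA ->
  phase_spec (map_mx Num.conj QA *m A) A PB QB J YB ->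
  phase_spec (map_mx Num.conj QB *m A^T) A^T PC QC I YC ->
  phase_spec (rowsub I A) A PD QD J' YD ->
  let Rw := rowsub I A in
  let Cl := colsub J A in
  let Cl' := colsub J' A in
  let Ahat := mxsub I J' A in
  let X := A - Cl *m pinvmp Cl *m A *m pinvmp Rw *m Rw in
  let X' := A - Cl' *m invmx Ahat *m Rw in
  [/\ fsq X <= (2 * r + 2)%N%:R * fsq (A - Z),
      forall c, sqbound (A - Z) c -> sqbound X ((2 + 2 * r * (minn M N - r))%N%:R * c)
    & (r <= \rank A)%N ->
      [/\ Ahat \in unitmx,
          fsq X' <= ((r + 1) ^ 2)%N%:R * fsq (A - Z)
        & forall c, sqbound (A - Z) c ->
            sqbound X' ((1 + r * (r + 2) * (minn M N - r))%N%:R * c)]].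
Proof.
move=> rZ sA sB sC sD Rw Cl Cl' Ahat X X'.
have [pA tA _ leA [_ _]] := sA; have [pB tB WB leB [_ selB]] := sB.
have [pC tC WC _ [_ selC]] := sC; have [pD tD WD _ [_ selD]] := sD.
set mu := (minn M N - r)%N.
(* PA lies in the row space of Z^T and has the same rank, so it captures all of Z^T; transposing
   turns this into a projector on the columns of Z. *)
have ZA : PA^T *m Z = Z.
  have PZ : (PA <= Z^T)%MS by apply: leA; rewrite ?sub0mx // mxrank_tr rZ.
  have /submxP[K ZK] : (Z^T <= PA)%MS.
    by rewrite -(mxrank_leqif_sup PZ) (orthoproj_rank pA tA) mxrank_tr rZ.
  by rewrite -[Z in LHS]trmxK -trmx_mul ZK -mulmxA pA.2 -ZK trmxK.
(* Through this identity every later bound refers to A - Z. *)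
have EA : (1%:M - PA^T) *m A = (1%:M - PA^T) *m (A - Z).
  have z : (1%:M - PA^T) *m Z = 0 by rewrite mulmxBl mul1mx ZA subrr.
  by rewrite [RHS]mulmxBr z subr0.
have pAT := orthoproj_tr pA; have pBT := orthoproj_tr pB.
have tAT : \tr PA^T = r%:R by rewrite mxtrace_tr.
have tBT : \tr PB^T = r%:R by rewrite mxtrace_tr.
have linkB : PA^T *m A *m PB = PA^T *m A by apply: phase_link sA WB.
have linkC : PB^T *m A^T *m PC = PB^T *m A^T by apply: phase_link sB WC.
have EB : (1%:M - PB^T) *m A^T = (A *m (1%:M - PB))^T.
  by rewrite trmx_mul linearB /= trmx1.
pose fA := fsq (A - Z).
have resB c : sqbound (A - Z) c ->
    [/\ sqbound (A *m (1%:M - PB)) c, fsq (A *m (1%:M - PB)) <= fA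
      & fsq (A *m (1%:M - PB)) <= mu%:R * c].
  move=> Zc; have := residual_bounds pAT tAT pB tB linkB; rewrite EA => /(_ c).
  case=> [|b1 b2 b3]; first by apply: sqbound_projl Zc; exact: orthoproj_compl.
  by split=> //; apply: le_trans b2 _; apply: fsq_projl_le; exact: orthoproj_compl.
have resC c : sqbound (A - Z) c ->
    [/\ sqbound (A^T *m (1%:M - PC)) c, fsq (A^T *m (1%:M - PC)) <= fA
      & fsq (A^T *m (1%:M - PC)) <= mu%:R * c].
  move=> /resB[b1 b2 b3]; have := residual_bounds pBT tBT pC tC linkC; rewrite EB => /(_ c).
  rewrite fsq_tr minnC -/mu; case=> [|c1 c2 c3]; first exact: sqbound_tr.
  by split=> //; exact: le_trans b2.
have c0 := sqbound_fsq (A - Z).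
(* The one-sided errors. Projecting them orthogonally to Cl and Rw eliminates the coefficients YB
   and YC without increasing any norm. *)
pose F := A - Cl *m YB; pose F' := A - YC^T *m Rw.
have F'T : F' = (A^T - colsub I A^T *m YC)^T.
  rewrite linearB /= trmx_mul trmxK; congr (_ - _ *m _).
  by apply/matrixP=> i j; rewrite !mxE.
have Ff : fsq F <= r.+1%:R * fA.
  have [_ _ _ h] := selB; apply: le_trans h _; rewrite ler_wpM2l //.
  by have [] := resB _ c0.
have Ff' : fsq F' <= r.+1%:R * fA.
  have [_ _ _ h] := selC; rewrite F'T fsq_tr; apply: le_trans h _; rewrite ler_wpM2l //.
  by have [] := resC _ c0.
have Fb c : sqbound (A - Z) c -> sqbound F (c + r%:R * (mu%:R * c)).
  by move=> /resB[b1 b2 b3]; exact: selection_bound selB b1 b3.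
have Fb' c : sqbound (A - Z) c -> sqbound F' (c + r%:R * (mu%:R * c)).
  by move=> /resC[b1 b2 b3]; rewrite F'T; apply/sqbound_tr; exact: selection_bound selC b1 b3.
have [CXC XCX CXh XCh] := pinvmpP Cl; have [RXR XRX RXh XRh] := pinvmpP Rw.
have pCl : orthoproj (Cl *m pinvmp Cl) by split; rewrite // mulmxA CXC.
have pRw : orthoproj (pinvmp Rw *m Rw) by split; rewrite // mulmxA XRX.
have qCl := orthoproj_compl pCl; have qRw := orthoproj_compl pRw.
set G := Cl *m pinvmp Cl in CXC pCl qCl; set H := pinvmp Rw *m Rw in pRw qRw.
have GF : (1%:M - G) *m F = A - G *m A.
  have z : (1%:M - G) *m Cl = 0 by rewrite mulmxBl mul1mx CXC subrr.
  by rewrite [LHS]mulmxBr mulmxA z mul0mx subr0 mulmxBl mul1mx.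
have HF' : F' *m (1%:M - H) = A - A *m H.
  have z : Rw *m (1%:M - H) = 0 by rewrite mulmxBr mulmx1 mulmxA RXR subrr.
  by rewrite [LHS]mulmxBl -mulmxA z mulmx0 subr0 mulmxBr mulmx1.
have XE : X = (1%:M - G) *m F + G *m (F' *m (1%:M - H)).
  rewrite GF HF' [G *m (_ - _)]mulmxBr addrA subrK /X -/G.
  by rewrite -(mulmxA (G *m A)) -/H -(mulmxA G).
have XO : ctrmx ((1%:M - G) *m F) *m (G *m (F' *m (1%:M - H))) = 0.
  have z : (1%:M - G) *m G = 0 by rewrite mulmxBl mul1mx pCl.2 subrr.
  by rewrite ctrmxM qCl.1 mulmxA -(mulmxA (ctrmx F)) z mulmx0 mul0mx.
split.
- rewrite XE (fsq_add_orthol XO) -/fA.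
  apply: (@le_trans _ _ (r.+1%:R * fA + r.+1%:R * fA)); last first.
    have -> : (2 * r + 2 = r.+1 + r.+1)%N by lia.
    by rewrite natrD mulrDl.
  apply: lerD; first exact: le_trans (fsq_projl_le _ qCl) Ff.
  apply: le_trans (fsq_projl_le _ pCl) _.
  exact: le_trans (fsq_projr_le _ qRw) Ff'.
- move=> c Zc; rewrite XE.
  have -> : (2 + 2 * r * mu)%N%:R * c = (c + r%:R * (mu%:R * c)) + (c + r%:R * (mu%:R * c)).
    rewrite natrD !natrM; ring.
  apply: sqbound_add_orthol => //.
    by apply: sqbound_projl => //; exact: Fb.
  by apply: sqbound_projl => //; apply: sqbound_projr => //; exact: Fb'.
move=> rA.
(* As r <= rank A, PB = K A for some K, while PB^T = L conj(QB). Then PB^T = PB^T PB^T = L conj(QB)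
   A^T K^T has rank r. *)
have rankW : \rank (map_mx Num.conj QB *m A^T) = r.
  apply/eqP; rewrite eqn_leq rank_leq_row /=.
  have PBA : (PB <= A)%MS.
    apply: leB => //; exact: submxMl.
  have [K PK] := submxP PBA.
  have [_ _ _ _ [[L PL] _]] := sB.
  have e : PB^T = L *m (map_mx Num.conj QB *m A^T) *m K^T.
    by rewrite mulmxA -PL -mulmxA -trmx_mul -PK -trmx_mul pB.2.
  have h : (r <= \rank PB^T)%N by rewrite (orthoproj_rank pBT tBT).
  apply: leq_trans h _; rewrite e.
  by apply: leq_trans (mxrankM_maxl _ _) _; exact: mxrankM_maxr.
(* The row selection reproduces conj(QB) A^T, of rank r, from its columns I, which are conj(QB)
   Rw^T. *)
have rankR : \rank Rw = r.
  apply/eqP; rewrite eqn_leq rank_leq_row /= -[X in (X <= _)%N]rankW.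
  have [_ h _ _] := selC; rewrite (h _ _ WC).
  apply: leq_trans (mxrankM_maxl _ _) _.
  have -> : colsub I (map_mx Num.conj QB *m A^T) = map_mx Num.conj QB *m Rw^T.
    by apply/matrixP=> i j; rewrite !mxE; apply: eq_bigr => k _; rewrite !mxE.
  by apply: leq_trans (mxrankM_maxr _ _) _; rewrite mxrank_tr.
(* PD captures Rw, and Ahat consists of the columns J' of Rw. Equality of ranks then makes Ahat
   invertible. *)
have RY : Rw = Ahat *m YD.
  have [_ h _ _] := selD; rewrite [LHS](h _ _ WD); congr (_ *m _).
  by apply/matrixP=> i j; rewrite !mxE.
have uA : Ahat \in unitmx.
  rewrite -row_full_unit /row_full eqn_leq rank_leq_row /= -[X in (X <= _)%N]rankR {1}RY.
  exact: mxrankM_maxl.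
have X'E : X' = A - Cl' *m YD by rewrite /X' RY -mulmxA mulKmx.
have ED : A *m (1%:M - PD) = F' *m (1%:M - PD).
  have z : Rw *m (1%:M - PD) = 0 by rewrite mulmxBr mulmx1 WD subrr.
  by rewrite [RHS]mulmxBl -mulmxA z mulmx0 subr0.
have qD := orthoproj_compl pD.
have EDf : fsq (A *m (1%:M - PD)) <= fsq F' by rewrite ED fsq_projr_le.
split=> //.
- have [_ _ _ h] := selD; rewrite X'E; apply: le_trans h _.
  rewrite addn1 -mulnn natrM -mulrA ler_wpM2l //; exact: le_trans Ff'.
- move=> c Zc; rewrite X'E.
  (* The bound of F' contributes 1 + r mu, the new selection r times the Frobenius bound (r + 1) mu
     of F'; r + r (r + 1) = r (r + 2). *)
  have -> : (1 + r * (r + 2) * mu)%N%:R * c =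
    (c + r%:R * (mu%:R * c)) + r%:R * (r.+1%:R * (mu%:R * c)).
    rewrite -natr1 natrD !natrM natrD; ring.
  apply: (selection_bound pD selD).
    by rewrite ED; apply: sqbound_projr => //; exact: Fb'.
  have [_ _ _ h] := selC; apply: le_trans EDf _; rewrite F'T fsq_tr; apply: le_trans h _.
  by rewrite ler_wpM2l //; have [] := resC _ Zc.
Qed.

End CrossApproximation.

(** * Gram-Schmidt program *)

Notation reg a := (IAt a (INum 0)).
Notation cell a x y := (SLoc (Loc a x y)).
Notation twice e := (IAdd e e).

(* Integer registers: 6, 7 size of the matrix being processed, 8 number of
   stored rank-one terms, 9 main counter, 10-12 counters of [fill] and [SSum],
   13 chosen column, 14 scan counter.
   Scalar arrays: 2 candidate vectors, 3 and 4 vectors q_k and weights d_k with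
   P = sum_k q_k^* q_k / d_k (d_k = 0 for the unused ones, and x / 0 = 0), 5 and
   6 residual, 7-14 temporaries, 15 the constant 0. *)
Definition append_cmd : cmd :=
  CSeq (fill 4 (reg 8) (INum 1) (INum 1) 10 11 (cell 9 (INum 0) (INum 0)))
  (CSeq (fill 3 (reg 8) (INum 1) (reg 7) 10 11 (cell 8 (INum 0) (reg 11)))
        (CISet 8 (INum 0) (IAdd (reg 8) (INum 1)))).

Definition gs_coef_cmd : cmd :=
  fill 7 (INum 0) (twice (reg 2)) (INum 1) 10 11
    (SOp OpDiv (SSum 12 (reg 7) (SOp OpMul (cell 2 (reg 9) (reg 12))
                                           (SConj (cell 3 (reg 10) (reg 12)))))
               (cell 4 (reg 10) (INum 0))).

Definition gs_resid_cmd : cmd :=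
  fill 8 (INum 0) (INum 1) (reg 7) 10 11
    (SOp OpSub (cell 2 (reg 9) (reg 11))
               (SSum 12 (twice (reg 2)) (SOp OpMul (cell 7 (reg 12) (INum 0))
                                                   (cell 3 (reg 12) (reg 11))))).

Definition gs_norm_cmd : cmd :=
  fill 9 (INum 0) (INum 1) (INum 1) 10 11
    (SSum 12 (reg 7) (SOp OpMul (cell 8 (INum 0) (reg 12))
                                (SConj (cell 8 (INum 0) (reg 12))))).

(** [CIfI] skips once r terms are stored; [CIfS] compares the squared norm of the residual with 0,
    an exact test of linear dependence. *)
Definition gs_body : cmd :=
  CSeq gs_coef_cmd (CSeq gs_resid_cmd (CSeq gs_norm_cmd
    (CIfI (reg 2) (reg 8) CSkip
      (CIfS (Loc 9 (INum 0) (INum 0)) (Loc 15 (INum 0) (INum 0)) CSkip append_cmd)))).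

(** Zero weights suffice to discard the vectors of the previous phase. *)
Definition clear_cmd : cmd :=
  CSeq (fill 4 (INum 0) (twice (reg 2)) (INum 1) 10 11 (SNum 0))
  (CSeq (fill 15 (INum 0) (INum 1) (INum 1) 10 11 (SNum 0))
        (CISet 8 (INum 0) (INum 0))).

(** The r + 2m candidates are the rows to capture, those of the current matrix, and those of Z or
    its transpose. Each costs O(nr), and r <= m. *)
Definition gs_cmd : cmd :=
  CSeq clear_cmd (CFor 9 (IAdd (reg 2) (twice (reg 6))) gs_body).

Section GramSchmidt.
Variable R : realType.
Notation C := R[i].
Implicit Types (s : state R) (m n r K : nat) (Q D X : nat -> nat -> C).

Lemma execS c1 c2 s : exec (CSeq c1 c2) s = exec c2 (exec c1 s).
Proof. by []. Qed.

Lemma execIfI e1 e2 c1 c2 s :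
  exec (CIfI e1 e2 c1 c2) s =
  if (ieval s e1 <= ieval s e2)%N then exec c1 s else exec c2 s.
Proof. by []. Qed.

Lemma execIfS x y c1 c2 s :
  exec (CIfS x y c1 c2) s =
  if complex.Re (sget s x) <= complex.Re (sget s y)
  then exec c1 (tick s) else exec c2 (tick s).
Proof. by []. Qed.

Lemma execFor a e c s :
  exec (CFor a e c) s = iteri (ieval s e) (fun k s' => exec c (iset s' a 0 k)) s.
Proof. by []. Qed.

Lemma smem_CISet a e v s : smem (exec (CISet a e v) s) = smem s.
Proof. by []. Qed.

Lemma imem_CISet a e v s b l :
  imem (exec (CISet a e v) s) b l =
  if (b == a) && (l == ieval s e) then ieval s v else imem s b l.
Proof. by []. Qed.

Lemma fill_at a row0 ei ej i j e s x y :
  fill_wf a row0 ej i j e -> (x < ieval s ei)%N -> (y < ieval s ej)%N ->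
  smem (exec (fill a row0 ei ej i j e) s) a (ieval s row0 + x) y =
  seval (iset (iset s i 0 x) j 0 y) e.
Proof. by move=> wf xi yj; rewrite fillP // leq_addr ltn_add2l xi yj /= addKn. Qed.

Definition row_of n X t : 'rV[C]_n := \row_j X t j.
Definition mx_of m n X : 'M[C]_(m, n) := \matrix_(i, j) X i j.
Definition proj_of n K Q D : 'M[C]_n :=
  \matrix_(a, b) \sum_(k < K) Num.conj (Q k a) * Q k b / D k 0%N.

Lemma proj_of_eq n K Q D Q' D' :
  (forall k b, Q' k b = Q k b) -> (forall k, D' k 0%N = D k 0%N) ->
  proj_of n K Q' D' = proj_of n K Q D.
Proof. by move=> QQ DD; apply/matrixP=> a b; rewrite !mxE; apply: eq_bigr => k _; rewrite !QQ DD. Qed.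

(** Slot c contributed nothing while its weight was 0, by the convention on inverses. The weight z
    is positive in Gram-Schmidt and negative in a pivot step. *)
Lemma proj_of_append n K Q D Q' D' c (y : 'rV[C]_n) z :
  (c < K)%N -> D c 0%N = 0 -> D' c 0%N = z -> (forall b : 'I_n, Q' c b = y 0 b) ->
  (forall k b, k != c -> Q' k b = Q k b) -> (forall k, k != c -> D' k 0%N = D k 0%N) ->
  proj_of n K Q' D' = proj_of n K Q D + z^-1 *: (ctrmx y *m y).
Proof.
move=> cK Dc D'c Q'c QQ DD; apply/matrixP=> a b; rewrite !mxE big_ord1 ctrmxE.
rewrite (bigD1 (Ordinal cK)) //= [in RHS](bigD1 (Ordinal cK)) //= Dc invr0 mulr0 add0r.
rewrite D'c !Q'c addrC [z^-1 * _]mulrC; congr (_ + _).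
by apply: eq_bigr => k kc; rewrite !QQ ?DD // -[c]/(val (Ordinal cK)) val_eqE.
Qed.

Lemma mul_proj_of n K Q D k (x : 'M[C]_(k, n)) i j :
  (x *m proj_of n K Q D) i j =
  \sum_(k < K) (\sum_(l < n) x i l * Num.conj (Q k l)) / D k 0%N * Q k j.
Proof.
rewrite mxE; under eq_bigr => l _ do rewrite mxE mulr_sumr.
rewrite exchange_big /=; apply: eq_bigr => l _; rewrite !mulr_suml.
by apply: eq_bigr => a _; rewrite !mulrA -!mulrA [_ * (D l 0%N)^-1]mulrC.
Qed.

Lemma append_cmdP s c n (s' := exec append_cmd s) :
  imem s 8 0 = c -> imem s 7 0 = n ->
  [/\ forall x y, smem s' 3 x y = if (x == c) && (y < n)%N then smem s 8 0 y else smem s 3 x y,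
      forall x, smem s' 4 x 0 = if x == c then smem s 9 0 0 else smem s 4 x 0
    & imem s' 8 0 = c.+1].
Proof.
move=> hc hn; rewrite {}/s' /append_cmd !execS; set s1 := exec (fill 4 _ _ _ _ _ _) s.
have c1 : imem s1 8 0 = c by rewrite /s1 frame_int.
have n1 : imem s1 7 0 = n by rewrite /s1 frame_int.
set s2 := exec (fill 3 _ _ _ _ _ _) s1.
have c2 : imem s2 8 0 = c by rewrite /s2 frame_int.
split.
- move=> x y; rewrite [LHS](_ : _ = smem s2 3 x y) // /s2 fillP //.
  rewrite (c1 : ieval s1 (reg 8) = c) (n1 : ieval s1 (reg 7) = n).
  rewrite (_ : [&& _, _ & _] = (x == c) && (y < n)%N); last by rewrite /=; lia.
  by case: ifP => _; rewrite -[RHS](frame_sc (c := fill 4 (reg 8) (INum 1) (INum 1) 10 11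
    (cell 9 (INum 0) (INum 0)))).
- move=> x; rewrite [LHS](_ : _ = smem s2 4 x 0) // /s2 frame_sc // /s1 fillP //.
  rewrite (hc : ieval s (reg 8) = c).
  by rewrite (_ : [&& _, _ & _] = (x == c)) //=; lia.
- by rewrite -c2 -[RHS]addn1.
Qed.

End GramSchmidt.

Section GramSchmidtLoop.
Variable R : realType.
Notation C := R[i].
Implicit Types (s : state R) (m n r K : nat) (Q D X : nat -> nat -> C).

Lemma gs_residP s t n r (s' := exec gs_resid_cmd (exec gs_coef_cmd s)) :
  imem s 9 0 = t -> imem s 7 0 = n -> imem s 2 0 = r ->
  row_of n (smem s' 8) 0 =
  row_of n (smem s 2) t *m (1%:M - proj_of n (r + r) (smem s 3) (smem s 4)).
Proof.
move=> ht hn hr; set s1 := exec gs_coef_cmd s.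
have n1 : imem s1 7 0 = n by rewrite /s1 frame_int.
have r1 : imem s1 2 0 = r by rewrite /s1 frame_int.
have t1 : imem s1 9 0 = t by rewrite /s1 frame_int.
have coef k : (k < r + r)%N -> smem s1 7 k 0 =
    (\sum_(l < n) smem s 2 t l * Num.conj (smem s 3 k l)) / smem s 4 k 0.
  move=> kr; rewrite -hn -ht; apply: fill_at => //.
  by rewrite -hr in kr.
set x := row_of _ _ t; set P := proj_of _ _ _ _.
apply/rowP=> j; have -> : (x *m (1%:M - P)) 0 j = x 0 j - (x *m P) 0 j.
  by rewrite mulmxBr mulmx1 mxE [X in _ + X]mxE.
rewrite mul_proj_of [LHS]mxE {1}/x mxE.
rewrite [X in _ - X](_ : _ = \sum_(k < r + r) smem s1 7 k 0 * smem s1 3 k j); last first.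
  apply: eq_bigr => k _; rewrite coef // /s1 frame_sc //; congr (_ / _ * _).
  by apply: eq_bigr => l _; rewrite mxE.
have -> : smem s 2 t j = smem s1 2 t j by rewrite /s1 frame_sc.
rewrite -r1 -t1; apply: (@fill_at _ _ (INum 0) (INum 1) _ _ _ _ _ 0) => //.
by rewrite (n1 : ieval s1 (reg 7) = n).
Qed.

Lemma gs_normP s n (s' := exec gs_norm_cmd s) :
  imem s 7 0 = n -> smem s' 9 0 0 = (fsq (row_of n (smem s 8) 0))%:C.
Proof.
move=> hn; rewrite fsqE /mxtrace big_ord1 mxE.
under eq_bigr => j _ do rewrite !mxE.
by rewrite -hn; apply: (@fill_at _ _ (INum 0) (INum 1) (INum 1) _ _ _ _ 0 0).
Qed.

Section Loop.
Variables (n m r : nat) (X : nat -> nat -> C).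

Definition first_rows t : 'M[C]_(t, n) := mx_of t n X.

(** While c < r every candidate seen is captured; afterwards candidates are dropped, but the first r
    remain captured, because c <= t means that none of them meets a full store. The last clause says
    that terms come from any initial segment that already has rank r. *)
Definition gs_inv t s : Prop :=
  let P := proj_of n (r + r) (smem s 3) (smem s 4) in
  exists2 c, [/\ imem s 8 0 = c, (c <= r)%N & (c <= t)%N] &
  [/\ [/\ imem s 2 0 = r, imem s 6 0 = m, imem s 7 0 = n, smem s 15 0 0 = 0
        & forall u j, smem s 2 u j = X u j],
      forall k, (c <= k < r + r)%N -> smem s 4 k 0 = 0,
      orthoproj P /\ \tr P = c%:R,
      forall u, (u < t)%N -> (c < r)%N || (u < r)%N -> row_of n X u *m P = row_of n X u
    & forall u, (t <= u)%N || (r <= \rank (first_rows u))%N -> (P <= first_rows u)%MS].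

Lemma row_first_rows t u : (u < t)%N -> (row_of n X u <= first_rows t)%MS.
Proof.
move=> ut; rewrite (_ : row_of n X u = row (Ordinal ut) (first_rows t)) ?row_sub //.
by apply/rowP=> j; rewrite !mxE.
Qed.

Lemma first_rows_mul t (P : 'M[C]_n) :
  (forall u, (u < t)%N -> row_of n X u *m P = row_of n X u) -> first_rows t *m P = first_rows t.
Proof.
move=> XP; apply/row_matrixP=> u; rewrite row_mul.
rewrite (_ : row u (first_rows t) = row_of n X u) ?XP //.
by apply/rowP=> j; rewrite !mxE.
Qed.

Lemma gs_init s : imem s 2 0 = r -> imem s 6 0 = m -> imem s 7 0 = n ->
  (forall u j, smem s 2 u j = X u j) -> gs_inv 0 (exec clear_cmd s).
Proof.
move=> hr hm hn hX; rewrite /gs_inv; set s' := exec _ s.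
pose s1 := exec (fill 4 (INum 0) (twice (reg 2)) (INum 1) 10 11 (SNum 0)) s.
pose s2 := exec (fill 15 (INum 0) (INum 1) (INum 1) 10 11 (SNum 0)) s1.
have s's2 : smem s' = smem s2 by [].
have D0 k : (k < r + r)%N -> smem s' 4 k 0 = 0.
  move=> kr; rewrite s's2 /s2 frame_sc //.
  by apply: (@fill_at _ _ (INum 0)) => //=; rewrite hr.
have P0 : proj_of n (r + r) (smem s' 3) (smem s' 4) = 0.
  apply/matrixP=> a b; rewrite !mxE big1 // => k _.
  by rewrite D0 // invr0 mulr0.
rewrite P0; exists 0%N; first by split.
split=> //.
- split; rewrite ?frame_int //.
  by move=> u j; rewrite frame_sc.
- split; last by rewrite mxtrace0.
  by split; rewrite ?ctrmx0 ?mul0mx.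
- by move=> u _; exact: sub0mx.
Qed.

Lemma gs_step t s : gs_inv t s -> gs_inv t.+1 (exec gs_body (iset s 9 0 t)).
Proof.
move=> [c [hc cr ct] [[hr hm hn h0 hX] hD [pP tP] hA hS]].
set P := proj_of _ _ _ _ in pP tP hA hS.
set s0 := iset s 9 0 t; rewrite /gs_body !execS.
set s2 := exec gs_resid_cmd _; set s3 := exec gs_norm_cmd s2.
have n2 : imem s2 7 0 = n by rewrite /s2 !frame_int.
have y2 : row_of n (smem s2 8) 0 = row_of n X t *m (1%:M - P).
  rewrite (@gs_residP s0 t n r) //; congr (_ *m _); apply/rowP=> j; rewrite !mxE.
  exact: hX.
have y3 : smem s3 9 0 0 = (fsq (row_of n X t *m (1%:M - P)))%:C.
  by rewrite /s3 (@gs_normP _ n) // y2.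
have i3 a l : a \notin [:: 9%N; 10%N; 11%N; 12%N] -> imem s3 a l = imem s a l.
  move=> ha; rewrite /s3 /s2 !(@frame_regs _ [:: 9; 10; 11; 12]%N) //.
  by move: ha; rewrite inE negb_or => /andP[/negPf a9 _]; rewrite /s0 /= a9.
have Q3 x y : smem s3 3 x y = smem s 3 x y by rewrite !frame_sc.
have D3 x : smem s3 4 x 0 = smem s 4 x 0 by rewrite !frame_sc.
have h3 : [/\ imem s3 2 0 = r, imem s3 6 0 = m, imem s3 7 0 = n, smem s3 15 0 0 = 0
        & forall u j, smem s3 2 u j = X u j].
  by split=> [||||u j]; rewrite ?i3 // !frame_sc // hX.
have c3 : imem s3 8 0 = c by rewrite i3.
have stay s' : (forall a l, imem s' a l = imem s3 a l) ->
    (forall a x y, smem s' a x y = smem s3 a x y) ->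
    ((c < r)%N -> row_of n X t *m (1%:M - P) = 0) -> gs_inv t.+1 s'.
  move=> hi hs xP; exists c; first by rewrite hi; split=> //; exact: leqW.
  rewrite (@proj_of_eq _ _ _ (smem s 3) (smem s 4)); last 2 first.
    by move=> k b; rewrite hs.
    by move=> k; rewrite hs.
  case: h3 => r3 m3 n3 z3 X3.
  split=> //; first by split; rewrite ?hi ?hs // => u j; rewrite hs.
  - by move=> k /hD; rewrite hs D3.
  - move=> u; rewrite ltnS leq_eqVlt => /orP[/eqP->|]; last exact: hA.
    move=> lt; have cr' : (c < r)%N by case/orP: lt => // tr; exact: leq_ltn_trans tr.
    by have := xP cr'; rewrite mulmxBr mulmx1 => /eqP; rewrite subr_eq0 => /eqP.
  - by move=> u /orP[tu|ru]; apply: hS; rewrite ?ru ?orbT // ltnW.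
have [r3 m3 n3 z3 X3] := h3.
rewrite execIfI execIfS (r3 : ieval s3 (reg 2) = r) (c3 : ieval s3 (reg 8) = c).
rewrite (y3 : sget s3 (Loc 9 (INum 0) (INum 0)) = _) (z3 : sget s3 (Loc 15 (INum 0) (INum 0)) = 0).
have ReC (a b : R) : (complex.Re a%:C <= complex.Re b%:C) = (a <= b) by [].
rewrite (ReC _ 0).
case: leqP => rc; first by apply: stay => //; rewrite ltnNge rc.
case: leP => y0.
  by apply: stay => // _; apply: fsq_eq0; apply/eqP; rewrite eq_le y0 fsq_ge0.
set s4 := exec append_cmd _.
have [Q4 D4 c4] := @append_cmdP _ (tick s3) c n c3 n3.
rewrite -/s4 in Q4 D4 c4.
set x := row_of n X t; set y := x *m (1%:M - P).
have y4 : forall b : 'I_n, smem s3 8 0 b = y 0 b.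
  move=> b; rewrite /s3 frame_sc //; have /rowP/(_ b) := y2; by rewrite mxE.
have P4 : proj_of n (r + r) (smem s4 3) (smem s4 4) = P + ((fsq y)^-1)%:C *: (ctrmx y *m y).
  rewrite fmorphV; apply: (@proj_of_append _ _ _ _ _ _ _ c).
  - exact: leq_trans rc (leq_addr _ _).
  - by apply: hD; rewrite leqnn /= (leq_trans rc) ?leq_addr.
  - by rewrite D4 eqxx [LHS]y3.
  - by move=> b; rewrite Q4 eqxx ltn_ord [LHS]y4.
  - by move=> k b kc; rewrite Q4 (negPf kc) [LHS]Q3.
  - by move=> k kc; rewrite D4 (negPf kc) [LHS]D3.
have yn0 : y != 0.
  by apply: contraTneq (y0 : 0 < fsq y) => ->; rewrite fsq0 ltxx.
have [pP' tP' xP' keep sub] := orthoproj_extend pP tP yn0; rewrite -/y -P4 in pP' tP' xP' keep sub.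
exists c.+1; first by rewrite c4; split.

split=> //.
- have i4 a l : a \notin [:: 8; 10; 11]%N -> imem s4 a l = imem s3 a l.
    by move=> al; rewrite /s4 (@frame_regs _ [:: 8; 10; 11]%N).
  by split=> [||||u j]; rewrite ?i4 // /s4 frame_sc //; exact: X3.
- move=> k /andP[ck kr]; rewrite D4 gtn_eqF //= [LHS]D3; apply: hD.
  by rewrite (ltnW ck).
- move=> u; rewrite ltnS leq_eqVlt => /orP[/eqP->|ut] lt; first exact: xP'.
  by apply: keep; apply: hA => //; rewrite rc.
- move=> u /orP[tu|ru].
    by apply: sub; [apply: hS; rewrite ltnW | exact: row_first_rows].
  (* Otherwise the first u rows, of rank at least r, would be captured by P of rank c < r. *)
  have tu : (t < u)%N.
    rewrite ltnNge; apply/negP=> ut.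
    have uP : first_rows u *m P = first_rows u.
      by apply: first_rows_mul => v vu; apply: hA; rewrite ?rc //; exact: leq_trans ut.
    have : (\rank (first_rows u) <= c)%N by rewrite -uP -(orthoproj_rank pP tP) mxrankM_maxr.
    by move/(leq_trans ru); rewrite leqNgt rc.
  by apply: sub; [apply: hS; rewrite ru orbT | exact: row_first_rows].
Qed.

Lemma gs_cmd_inv s :
  imem s 2 0 = r -> imem s 6 0 = m -> imem s 7 0 = n ->
  (forall u j, smem s 2 u j = X u j) -> gs_inv (r + (m + m)) (exec gs_cmd s).
Proof.
move=> hr hm hn hX; rewrite /gs_cmd execS; set s1 := exec clear_cmd s.
have inv1 : gs_inv 0 s1 by exact: gs_init.
rewrite execFor; have -> : ieval s1 (IAdd (reg 2) (twice (reg 6))) = (r + (m + m))%N.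
  by case: inv1 => c _ [[<- <- _ _ _]].
by apply: iteri_ind => // k s2 _; exact: gs_step.
Qed.

(** If fewer than r terms were stored, all candidates would be captured by a projector of rank below
    r, against the rank hypothesis. *)
Lemma gs_cmdP s (s' := exec gs_cmd s) :
  imem s 2 0 = r -> imem s 6 0 = m -> imem s 7 0 = n ->
  (forall u j, smem s 2 u j = X u j) -> (r <= \rank (first_rows (r + (m + m))))%N ->
  let P := proj_of n (r + r) (smem s' 3) (smem s' 4) in
  [/\ imem s' 8 0 = r, forall k, (r <= k < r + r)%N -> smem s' 4 k 0 = 0,
      orthoproj P /\ \tr P = r%:R,
      forall u, (u < r)%N -> row_of n X u *m P = row_of n X u
    & forall u, (r <= \rank (first_rows u))%N -> (P <= first_rows u)%MS].
Proof.
move=> hr hm hn hX rk; have := gs_cmd_inv hr hm hn hX; rewrite -/s'.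
case=> c [hc cr _] [_ hD [pP tP] hA hS]; set P := proj_of _ _ _ _ in pP tP hA hS *.
have cE : c = r.
  apply/eqP; rewrite eqn_leq cr leqNgt; apply/negP => lt.
  have uP : first_rows (r + (m + m)) *m P = first_rows (r + (m + m)).
    by apply: first_rows_mul => v vu; apply: hA; rewrite ?lt.
  have : (\rank (first_rows (r + (m + m))) <= c)%N.
    by rewrite -uP -(orthoproj_rank pP tP) mxrankM_maxr.
  by move/(leq_trans rk); rewrite leqNgt lt.
rewrite cE in hc hD tP hA; split=> //.
- by move=> u ur; apply: hA; rewrite ?ur ?orbT //; exact: leq_trans ur (leq_addr _ _).
- by move=> u ru; apply: hS; rewrite ru orbT.
Qed.

End Loop.
End GramSchmidtLoop.

(** * Greedy selection program *)

Definition res_coef_cmd : cmd :=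
  fill 7 (INum 0) (reg 6) (twice (reg 2)) 10 11
    (SOp OpDiv (SSum 12 (reg 7) (SOp OpMul (cell 2 (IAdd (reg 2) (reg 10)) (reg 12))
                                           (SConj (cell 3 (reg 11) (reg 12)))))
               (cell 4 (reg 11) (INum 0))).

Definition res_fill_cmd : cmd :=
  fill 5 (INum 0) (reg 6) (reg 7) 10 11
    (SOp OpSub (cell 2 (IAdd (reg 2) (reg 10)) (reg 11))
               (SSum 12 (twice (reg 2)) (SOp OpMul (cell 7 (reg 10) (reg 12))
                                                   (cell 3 (reg 12) (reg 11))))).

Definition res_cmd : cmd := CSeq res_coef_cmd res_fill_cmd.

(** P itself is never formed: a pivot step needs only its diagonal and one row, at O(r) per
    entry. *)
Definition proj_entry (a b : iexp) : sexp :=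
  SSum 12 (twice (reg 2))
    (SOp OpDiv (SOp OpMul (SConj (cell 3 (reg 12) a)) (cell 3 (reg 12) b))
               (cell 4 (reg 12) (INum 0))).

Definition diag_cmd : cmd :=
  fill 10 (INum 0) (INum 1) (reg 7) 10 11 (proj_entry (reg 11) (reg 11)).

Definition colnorm_cmd : cmd :=
  fill 11 (INum 0) (INum 1) (reg 7) 10 11
    (SSum 12 (reg 6) (SOp OpMul (cell 5 (reg 12) (reg 11)) (SConj (cell 5 (reg 12) (reg 11))))).

(** No command turns an integer into a scalar, so the trace r - t is obtained by summing the
    diagonal. *)
Definition trace_cmd : cmd :=
  fill 12 (INum 0) (INum 1) (INum 1) 10 11 (SSum 12 (reg 7) (cell 10 (INum 0) (reg 12))).

Definition total_cmd : cmd :=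
  fill 9 (INum 0) (INum 1) (INum 1) 10 11 (SSum 12 (reg 7) (cell 11 (INum 0) (reg 12))).

Definition lhs_cmd : cmd :=
  fill 13 (INum 0) (INum 1) (reg 7) 10 11
    (SOp OpMul (cell 11 (INum 0) (reg 11)) (cell 12 (INum 0) (INum 0))).

Definition rhs_cmd : cmd :=
  fill 14 (INum 0) (INum 1) (reg 7) 10 11
    (SOp OpMul (cell 10 (INum 0) (reg 11)) (cell 9 (INum 0) (INum 0))).

Definition score_cmd : cmd :=
  CSeq diag_cmd (CSeq colnorm_cmd (CSeq trace_cmd (CSeq total_cmd (CSeq lhs_cmd rhs_cmd)))).

(* Keeps the last column j with P_jj > 0 and |e_j|^2 tr P <= P_jj |E|_F^2. *)
Definition scan_body : cmd :=
  CIfS (Loc 10 (INum 0) (reg 14)) (Loc 15 (INum 0) (INum 0)) CSkip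
    (CIfS (Loc 13 (INum 0) (reg 14)) (Loc 14 (INum 0) (reg 14))
       (CISet 13 (INum 0) (reg 14)) CSkip).

Definition scan_cmd : cmd :=
  CSeq (CISet 13 (INum 0) (INum 0)) (CFor 14 (reg 7) scan_body).

Definition proj_row_cmd : cmd :=
  fill 8 (INum 0) (INum 1) (reg 7) 10 11 (proj_entry (reg 13) (reg 11)).

(** The result goes to array 6 because column j of the old residual is read up to the last entry. *)
Definition update_cmd : cmd :=
  fill 6 (INum 0) (reg 6) (reg 7) 10 11
    (SOp OpSub (cell 5 (reg 10) (reg 11))
       (SOp OpMul (SOp OpDiv (cell 5 (reg 10) (reg 13)) (cell 8 (INum 0) (reg 13)))
                  (cell 8 (INum 0) (reg 11)))).

Definition copy_back_cmd : cmd :=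
  fill 5 (INum 0) (reg 6) (reg 7) 10 11 (cell 6 (reg 10) (reg 11)).

Definition weight_cmd : cmd :=
  fill 9 (INum 0) (INum 1) (INum 1) 10 11
    (SOp OpSub (SNum 0) (cell 8 (INum 0) (reg 13))).

Definition pivot_cmd : cmd :=
  CSeq proj_row_cmd (CSeq update_cmd (CSeq copy_back_cmd (CSeq weight_cmd append_cmd))).

Definition greedy_core : cmd := CSeq score_cmd (CSeq scan_cmd pivot_cmd).

Definition greedy_body (out : nat) : cmd :=
  CSeq greedy_core (CISet out (reg 9) (reg 13)).

Definition select_cmd (out : nat) : cmd :=
  CSeq gs_cmd (CSeq res_cmd (CFor 9 (reg 2) (greedy_body out))).

Section Greedy.
Variable R : realType.
Notation C := R[i].
Implicit Types (s : state R) (m n r : nat).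

Lemma res_cmdP s m n r (s' := exec res_cmd s) :
  imem s 6 0 = m -> imem s 7 0 = n -> imem s 2 0 = r ->
  mx_of m n (smem s' 5) =
  mx_of m n (fun i => smem s 2 (r + i)%N) *m
    (1%:M - proj_of n (r + r) (smem s 3) (smem s 4)).
Proof.
move=> hm hn hr; rewrite {}/s' /res_cmd execS; set s1 := exec res_coef_cmd s.
have m1 : imem s1 6 0 = m by rewrite /s1 frame_int.
have n1 : imem s1 7 0 = n by rewrite /s1 frame_int.
have r1 : imem s1 2 0 = r by rewrite /s1 frame_int.
have coef i k : (i < m)%N -> (k < r + r)%N -> smem s1 7 i k =
    (\sum_(l < n) smem s 2 (r + i) l * Num.conj (smem s 3 k l)) / smem s 4 k 0.
  move=> im kr; rewrite -hn -{1}hr; apply: (@fill_at _ _ (INum 0)) => //.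
    by rewrite (hm : ieval s (reg 6) = m).
  by rewrite -hr in kr.
set B := mx_of m n (fun i => smem s 2 (r + i)%N); set P := proj_of _ _ _ _.
apply/matrixP=> i j; have -> : (B *m (1%:M - P)) i j = B i j - (B *m P) i j.
  by rewrite mulmxBr mulmx1 mxE [X in _ + X]mxE.
rewrite mul_proj_of [LHS]mxE {1}/B mxE.
rewrite [X in _ - X](_ : _ = \sum_(k < r + r) smem s1 7 i k * smem s1 3 k j); last first.
  apply: eq_bigr => k _; rewrite coef // /s1 frame_sc //; congr (_ / _ * _).
  by apply: eq_bigr => l _; rewrite mxE.
have -> : smem s 2 (r + i) j = smem s1 2 (r + i) j by rewrite /s1 frame_sc.
rewrite -r1; apply: (@fill_at _ _ (INum 0)) => //.
  by rewrite (m1 : ieval s1 (reg 6) = m).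
by rewrite (n1 : ieval s1 (reg 7) = n).
Qed.

Lemma score_cmdP s m n r (s' := exec score_cmd s)
    (P := proj_of n (r + r) (smem s 3) (smem s 4)) (E := mx_of m n (smem s 5)) k :
  imem s 6 0 = m -> imem s 7 0 = n -> imem s 2 0 = r ->
  orthoproj P -> \tr P = k%:R ->
  forall j : 'I_n, [/\ smem s' 10 0 j = (fsq (row j P))%:C,
    smem s' 13 0 j = (fsq (col j E) * k%:R)%:C
    & smem s' 14 0 j = (fsq (row j P) * fsq E)%:C].
Proof.
move=> hm hn hr pP tP; rewrite {}/s' /score_cmd !execS.
set s1 := exec diag_cmd s; set s2 := exec colnorm_cmd s1; set s3 := exec trace_cmd s2.
set s4 := exec total_cmd s3; set s5 := exec lhs_cmd s4; set s6 := exec rhs_cmd s5.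
have n1 : imem s1 7 0 = n by rewrite /s1 frame_int.
have m1 : imem s1 6 0 = m by rewrite /s1 frame_int.
have n2 : imem s2 7 0 = n by rewrite /s2 frame_int.
have n3 : imem s3 7 0 = n by rewrite /s3 frame_int.
have n4 : imem s4 7 0 = n by rewrite /s4 frame_int.
have n5 : imem s5 7 0 = n by rewrite /s5 frame_int.
have v1 (j : 'I_n) : smem s1 10 0 j = (fsq (row j P))%:C.
  rewrite -orthoproj_diag // mxE -hr; apply: (@fill_at _ _ (INum 0) (INum 1) _ _ _ _ _ 0) => //.
  by rewrite (hn : ieval s (reg 7) = n).
have v2 (j : 'I_n) : smem s2 11 0 j = (fsq (col j E))%:C.
  rewrite fsqE mxtrace_mulC /mxtrace big_ord1 mxE.
  rewrite (eq_bigr (fun i : 'I_m => smem s1 5 i j * Num.conj (smem s1 5 i j))).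
    rewrite -m1; apply: (@fill_at _ _ (INum 0) (INum 1) _ _ _ _ _ 0) => //.
    by rewrite (n1 : ieval s1 (reg 7) = n).
  by move=> i _; rewrite !mxE mulrC /s1 frame_sc.
have v3 : smem s3 12 0 0 = (k%:R)%:C.
  rewrite -(orthoproj_diag_sum pP tP) rmorph_sum.
  rewrite (eq_bigr (fun j : 'I_n => smem s2 10 0 j)).
    rewrite -n2; apply: (@fill_at _ _ (INum 0) (INum 1) (INum 1) _ _ _ _ 0 0) => //.
  by move=> j _; apply: etrans (esym (v1 j)) _; rewrite /s2 frame_sc.
have v4 : smem s4 9 0 0 = (fsq E)%:C.
  rewrite fsq_col rmorph_sum.
  rewrite (eq_bigr (fun j : 'I_n => smem s3 11 0 j)).
    rewrite -n3; apply: (@fill_at _ _ (INum 0) (INum 1) (INum 1) _ _ _ _ 0 0) => //.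
  by move=> j _; apply: etrans (esym (v2 j)) _; rewrite /s3 frame_sc.
move=> j; split.
- by rewrite -v1 /s6 /s5 /s4 /s3 /s2; do 5!rewrite frame_sc //.
- rewrite /s6 frame_sc //; apply: (@etrans _ _ (smem s4 11 0 j * smem s4 12 0 0)).
    apply: (@fill_at _ _ (INum 0) (INum 1) _ _ _ _ _ 0) => //.
    by rewrite (n4 : ieval s4 (reg 7) = n).
  have -> : smem s4 11 0 j = (fsq (col j E))%:C.
    by rewrite -v2 /s4 /s3; do 2!rewrite frame_sc //.
  have -> : smem s4 12 0 0 = (k%:R)%:C by rewrite -v3 /s4 frame_sc.
  exact/esym/rmorphM.
- apply: (@etrans _ _ (smem s5 10 0 j * smem s5 9 0 0)).
    apply: (@fill_at _ _ (INum 0) (INum 1) _ _ _ _ _ 0) => //.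
    by rewrite (n5 : ieval s5 (reg 7) = n).
  have -> : smem s5 10 0 j = (fsq (row j P))%:C.
    by rewrite -v1 /s5 /s4 /s3 /s2; do 4!rewrite frame_sc //.
  have -> : smem s5 9 0 0 = (fsq E)%:C by rewrite -v4 /s5 frame_sc.
  exact/esym/rmorphM.
Qed.

Lemma scan_cmdP s n (s' := exec scan_cmd s) (d u v : nat -> R) :
  imem s 7 0 = n -> smem s 15 0 0 = 0 ->
  (forall j, (j < n)%N -> [/\ smem s 10 0 j = (d j)%:C, smem s 13 0 j = (u j)%:C
                           & smem s 14 0 j = (v j)%:C]) ->
  (exists2 j, (j < n)%N & (0 < d j) && (u j <= v j)) ->
  exists2 j, (j < n)%N & imem s' 13 0 = j /\ (0 < d j) && (u j <= v j).
Proof.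
move=> hn hz hv ex; rewrite {}/s' /scan_cmd execS.
set s0 := exec (CISet _ _ _) s; rewrite execFor (hn : ieval s0 (reg 7) = n).
pose Inv k s1 := (forall a x y, smem s1 a x y = smem s a x y) /\
  ((exists2 j, (j < k)%N & (0 < d j) && (u j <= v j)) ->
   exists2 j, (j < n)%N & imem s1 13 0 = j /\ (0 < d j) && (u j <= v j)).
suff [_ ] : Inv n (iteri n (fun k s1 => exec scan_body (iset s1 14 0 k)) s0) by apply.
apply: (iteri_ind (P := Inv)); first by split=> // -[].
move=> k s1 kn [hs IH]; have [h10 h13 h14] := hv k kn.
rewrite /scan_body execIfS.
set s2 := iset s1 14 0 k.
rewrite [sget s2 (Loc 10 _ _)](_ : _ = (d k)%:C); last by rewrite -h10 -hs.
rewrite [sget s2 (Loc 15 _ _)](_ : _ = 0%:C); last exact: etrans (hs _ _ _) hz.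
have ReC (a b : R) : (complex.Re a%:C <= complex.Re b%:C) = (a <= b) by [].
have old (bad : ~~ ((0 < d k) && (u k <= v k))) :
    (exists2 j, (j < k.+1)%N & (0 < d j) && (u j <= v j)) ->
    exists2 j, (j < n)%N & imem s1 13 0 = j /\ (0 < d j) && (u j <= v j).
  case=> j; rewrite ltnS leq_eqVlt => /orP[/eqP->|jk] good; first by rewrite good in bad.
  by apply: IH; exists j.
rewrite ReC; case: leP => dk.
  split=> [a x y|]; first exact: hs.
  by apply: old; rewrite ltNge dk.
rewrite execIfS.
rewrite [sget (tick s2) (Loc 13 _ _)](_ : _ = (u k)%:C); last by rewrite -h13 -hs.
rewrite [sget (tick s2) (Loc 14 _ _)](_ : _ = (v k)%:C); last by rewrite -h14 -hs.
rewrite ReC; case: leP => uk.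
  split=> [a x y|_]; first exact: hs.
  by exists k => //; split=> //; rewrite dk uk.
split=> [a x y|]; first exact: hs.
by apply: old; rewrite leNgt uk andbF.
Qed.

Lemma pivot_cmdP s m n r c (s' := exec pivot_cmd s) (j : 'I_n)
    (P := proj_of n (r + r) (smem s 3) (smem s 4)) (E := mx_of m n (smem s 5)) :
  imem s 6 0 = m -> imem s 7 0 = n -> imem s 2 0 = r -> imem s 8 0 = c ->
  imem s 13 0 = j -> (c < r + r)%N -> smem s 4 c 0 = 0 -> orthoproj P ->
  [/\ proj_of n (r + r) (smem s' 3) (smem s' 4) = pivot P j P,
      mx_of m n (smem s' 5) = pivot P j E, imem s' 8 0 = c.+1,
      forall x y, x != c -> smem s' 3 x y = smem s 3 x y
    & forall x, x != c -> smem s' 4 x 0 = smem s 4 x 0].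
Proof.
move=> hm hn hr hc hj cr Dc pP; rewrite {}/s' /pivot_cmd 4!execS.
set s1 := exec proj_row_cmd s; set s2 := exec update_cmd s1.
set s3 := exec copy_back_cmd s2; set s4 := exec weight_cmd s3.
have i1 a l : a \notin [:: 10; 11; 12]%N -> imem s1 a l = imem s a l.
  by move=> al; rewrite /s1 (@frame_regs _ [:: 10; 11; 12]%N).
have i2 a l : a \notin [:: 10; 11; 12]%N -> imem s2 a l = imem s a l.
  by move=> al; rewrite /s2 (@frame_regs _ [:: 10; 11; 12]%N) ?i1.
have i3 a l : a \notin [:: 10; 11; 12]%N -> imem s3 a l = imem s a l.
  by move=> al; rewrite /s3 (@frame_regs _ [:: 10; 11; 12]%N) ?i2.
have i4 a l : a \notin [:: 10; 11; 12]%N -> imem s4 a l = imem s a l.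
  by move=> al; rewrite /s4 (@frame_regs _ [:: 10; 11; 12]%N) ?i3.
have v1 (b : 'I_n) : smem s1 8 0 b = P j b.
  rewrite mxE -hr -hj; apply: (@fill_at _ _ (INum 0) (INum 1) _ _ _ _ _ 0) => //.
  by rewrite (hn : ieval s (reg 7) = n).
have v2 (i : 'I_m) (b : 'I_n) : smem s2 6 i b = E i b - E i j / P j j * P j b.
  have m1 : ieval s1 (reg 6) = m by rewrite -hm -i1.
  have n1 : ieval s1 (reg 7) = n by rewrite -hn -i1.
  have j1 : imem s1 13 0 = j by rewrite i1.
  rewrite -!v1 !mxE.
  have e5 x y : smem s 5 x y = smem s1 5 x y by rewrite /s1 frame_sc.
  rewrite !e5 -j1; apply: (@fill_at _ _ (INum 0)) => //; rewrite ?m1 ?n1 //.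
have v3 (i : 'I_m) (b : 'I_n) : smem s3 5 i b = E i b - E i j / P j j * P j b.
  have m2 : ieval s2 (reg 6) = m by rewrite -hm -i2.
  have n2 : ieval s2 (reg 7) = n by rewrite -hn -i2.
  rewrite -v2; apply: (@fill_at _ _ (INum 0)) => //; rewrite ?m2 ?n2 //.
have v4 : smem s4 9 0 0 = - P j j.
  have j3 : imem s3 13 0 = j by rewrite i3.
  rewrite -v1 -[RHS]add0r; have -> : smem s1 8 0 j = smem s3 8 0 j by rewrite /s3 /s2; do 2!rewrite frame_sc //.
  rewrite -j3; apply: (@fill_at _ _ (INum 0) (INum 1) (INum 1) _ _ _ _ 0 0) => //.
have c4 : imem s4 8 0 = c by rewrite i4.
have n4 : imem s4 7 0 = n by rewrite i4.
have [Q5 D5 c5] := append_cmdP c4 n4; set s5 := exec append_cmd s4 in Q5 D5 c5 *.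
have Q4 x y : smem s4 3 x y = smem s 3 x y by rewrite /s4 /s3 /s2 /s1; do 4!rewrite frame_sc //.
have D4 x y : smem s4 4 x y = smem s 4 x y by rewrite /s4 /s3 /s2 /s1; do 4!rewrite frame_sc //.
split; last 3 first.
- exact: c5.
- by move=> x y xc; rewrite Q5 (negPf xc) Q4.
- by move=> x xc; rewrite D5 (negPf xc) D4.
- rewrite (@proj_of_append _ _ _ (smem s 3) (smem s 4) _ _ c (row j P) (- P j j)).
  + rewrite -/P /pivot orthoproj_ctrE // orthoproj_diag // invrN scaleNr.
    by rewrite -fmorphV.
  + exact: cr.
  + exact: Dc.
  + by rewrite D5 eqxx v4.
  + by move=> b; rewrite Q5 eqxx ltn_ord /= mxE -v1 /s4 /s3 /s2; do 3!rewrite frame_sc //.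
  + by move=> k b kc; rewrite Q5 (negPf kc) Q4.
  + by move=> k kc; rewrite D5 (negPf kc) D4.
- apply/matrixP=> a b; rewrite mxE frame_sc // /s4 frame_sc // v3 pivotE.
  by rewrite (orthoproj_diag _ pP) fmorphV mulrA [_ / _]mulrC.
Qed.

End Greedy.

Section Selection.
Variable R : realType.
Notation C := R[i].
Implicit Types (s : state R).

Lemma Re_eq (z : C) (x : R) : z = x%:C -> z = (complex.Re z)%:C.
Proof. by move->. Qed.

Section Loop.
Variables (m n r out : nat) (P0 : 'M[C]_n) (E0 : 'M[C]_(m, n)) (Q0 : nat -> nat -> C).
Hypothesis out_ok : out \notin [:: 2; 6; 7; 8; 9; 10; 11; 12; 13; 14]%N.

(** Pivots append from slot r on, so the Gram-Schmidt vectors [Q0] survive; the next phase reads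
    them. *)
Definition loop_inv t s : Prop :=
  [/\ imem s 6 0 = m, imem s 7 0 = n, imem s 2 0 = r, imem s 8 0 = (r + t)%N
    & smem s 15 0 0 = 0] /\
  [/\ forall k, (r + t <= k < r + r)%N -> smem s 4 k 0 = 0,
      forall k b, (k < r)%N -> smem s 3 k b = Q0 k b
    & exists T, greedy_inv r t P0 E0 (imem s out)
        (proj_of n (r + r) (smem s 3) (smem s 4)) (mx_of m n (smem s 5)) T].

Lemma loop_step t s : (t < r)%N -> loop_inv t s ->
  loop_inv t.+1 (exec (greedy_body out) (iset s 9 0 t)).
Proof.
move=> tr [[hm hn hr hc hz] [hD hQ [T inv]]].
set P := proj_of _ _ _ _ in inv; set E := mx_of _ _ _ in inv.
have [[pP tP _ _] _] := inv.
set s0 := iset s 9 0 t; rewrite /greedy_body /greedy_core 3!execS.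
set s1 := exec score_cmd s0; set s2 := exec scan_cmd s1; set s3 := exec pivot_cmd s2.
have i0 a l : a != 9%N -> imem s0 a l = imem s a l by move=> /negPf a9; rewrite /s0 /= a9.
have i1 a l : a \notin [:: 9; 10; 11; 12]%N -> imem s1 a l = imem s a l.
  move=> al; rewrite /s1 (@frame_regs _ [:: 9; 10; 11; 12]%N) // i0 //.
  by apply: contra al => /eqP->.
have i2 a l : a \notin [:: 9; 10; 11; 12; 13; 14]%N -> imem s2 a l = imem s a l.
  move=> al; rewrite /s2 (@frame_regs _ [:: 9; 10; 11; 12; 13; 14]%N) // i1 //.
  by apply: contra al; rewrite !inE => /or4P[] ->; rewrite ?orbT.
have i3 a l : a \notin [:: 8; 9; 10; 11; 12; 13; 14]%N -> imem s3 a l = imem s a l.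
  move=> al; rewrite /s3 (@frame_regs _ [:: 8; 9; 10; 11; 12; 13; 14]%N) // i2 //.
  by move: al; rewrite inE negb_or => /andP[].
have m1 a x y : a \in [:: 3; 4; 5; 15]%N -> smem s1 a x y = smem s a x y.
  by rewrite !inE => /or4P[] /eqP->; rewrite /s1 frame_sc.
have m2 a x y : a \in [:: 3; 4; 5; 15]%N -> smem s2 a x y = smem s a x y.
  by move=> ha; rewrite /s2 frame_sc ?m1.
have score := @score_cmdP _ s0 m n r (r - t) hm hn hr pP tP.
rewrite -/s1 -/P -/E in score.
(* [CIfS] compares real parts; [score_cmdP] shows that the scores are real, so the comparison is
   faithful. *)
pose d k := complex.Re (smem s1 10 0 k).
pose u k := complex.Re (smem s1 13 0 k).
pose v k := complex.Re (smem s1 14 0 k).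
have hdv j : (j < n)%N -> [/\ smem s1 10 0 j = (d j)%:C, smem s1 13 0 j = (u j)%:C
    & smem s1 14 0 j = (v j)%:C].
  by move=> jn; have [e1 e2 e3] := score (Ordinal jn); split; [exact: Re_eq e1 | exact: Re_eq e2 | exact: Re_eq e3].
have n1 : imem s1 7 0 = n by rewrite i1.
have z1 : smem s1 15 0 0 = 0 by rewrite m1.
have duv (j : 'I_n) : [/\ d j = fsq (row j P), u j = fsq (col j E) * (r - t)%N%:R
    & v j = fsq (row j P) * fsq E].
  by have [] := score j; rewrite /d /u /v => -> -> ->.
have [|j0 j0n [pick /andP[d0 uv]]] := scan_cmdP n1 z1 hdv.
  have [|j [dj le]] := pivot_exists E pP tP; first by rewrite subn_gt0.
  by exists j => //; have [-> -> ->] := duv j; rewrite dj le.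
rewrite -/s2 in pick; pose j := Ordinal j0n.
have [dj uj vj] := duv j; rewrite dj in d0; rewrite uj vj in uv.
have P2 : proj_of n (r + r) (smem s2 3) (smem s2 4) = P.
  by apply: proj_of_eq => *; rewrite m2.
have E2 : mx_of m n (smem s2 5) = E by apply/matrixP=> a b; rewrite !mxE m2.
have h2m : imem s2 6 0 = m by rewrite i2.
have h2n : imem s2 7 0 = n by rewrite i2.
have h2r : imem s2 2 0 = r by rewrite i2.
have h2c : imem s2 8 0 = (r + t)%N by rewrite i2.
have ltc : (r + t < r + r)%N by rewrite ltn_add2l.
have D2 : smem s2 4 (r + t) 0 = 0 by rewrite m2 // hD // leqnn.
have := @pivot_cmdP _ s2 m n r (r + t) j h2m h2n h2r h2c pick ltc D2.
rewrite P2 E2 -/s3 => /(_ pP)[P3 E3 c3 Q3 D3].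
have t3 : imem s3 9 0 = t.
  by rewrite /s3 frame_int // /s2 frame_int // /s1 frame_int.
have p3 : imem s3 13 0 = j by rewrite /s3 frame_int.
have z3 : smem s3 15 0 0 = 0 by rewrite /s3 frame_sc // m2.
clearbody s3; set s4 := exec _ s3.
have sm4 : smem s4 = smem s3 := smem_CISet _ _ _ _.
have i4 a l : imem s4 a l = if (a == out) && (l == t) then j : nat else imem s3 a l.
  by rewrite -t3 -p3; exact: imem_CISet.
have i4' a l : a \in [:: 2; 6; 7; 8]%N -> imem s4 a l = imem s3 a l.
  move=> ha; rewrite i4; case: eqP => // ao; move: ha out_ok; rewrite ao !inE.
  by case/or4P=> ->; rewrite ?orbT.
have o3 l : imem s3 out l = imem s out l.
  apply: i3; apply: contra out_ok; rewrite !inE.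
  by do 6?[case/orP]; move=> ->; rewrite ?orbT.
split.
  by split; rewrite ?i4' ?sm4 ?c3 ?z3 ?i3 ?addnS.
split.
- move=> k /andP[ck kr]; rewrite sm4 D3 ?m2 ?hD //.
  + by rewrite kr andbT; apply: leq_trans ck; rewrite addnS.
  + by rewrite gtn_eqF // -addnS.
- move=> k b kr; rewrite sm4 Q3 ?m2 ?hQ // ltn_eqF //; exact: ltn_addr.
- exists (pivot P j T); rewrite sm4 P3 E3.
  apply: (greedy_step tr inv) => //.
  + by rewrite i4 !eqxx.
  + by move=> l lt; rewrite i4 (ltn_eqF lt) andbF.
Qed.

End Loop.

Lemma select_cmdP (m n r out : nat) s (W : 'M[C]_(r, n)) (B Zb : 'M[C]_(m, n))
    (s' := exec (select_cmd out) s) :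
  out \notin [:: 2; 6; 7; 8; 9; 10; 11; 12; 13; 14]%N ->
  imem s 6 0 = m -> imem s 7 0 = n -> imem s 2 0 = r ->
  (forall (k : 'I_r) (j : 'I_n), smem s 2 k j = W k j) ->
  (forall (k : 'I_m) (j : 'I_n), smem s 2 (r + k) j = B k j) ->
  (forall (k : 'I_m) (j : 'I_n), smem s 2 (r + m + k) j = Zb k j) ->
  (r <= \rank Zb)%N ->
  exists P J Y, phase_spec W B P (mx_of r n (smem s' 3)) J Y /\
    forall k : 'I_r, imem s' out k = J k.
Proof.
move=> ook hm hn hr hW hB hZ rZ; rewrite {}/s' /select_cmd 2!execS.
pose X := smem s 2.
have rowW (k : 'I_r) : row_of n X k = row k W by apply/rowP=> j; rewrite !mxE -hW.
have rowB (k : 'I_m) : row_of n X (r + k) = row k B by apply/rowP=> j; rewrite !mxE -hB.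
have rowZ (k : 'I_m) : row_of n X (r + m + k) = row k Zb by apply/rowP=> j; rewrite !mxE -hZ.
(* [Zb] supplies the rank r that the matrix B alone may lack. *)
have Zpre : (Zb <= first_rows n X (r + (m + m)))%MS.
  apply/row_subP=> i; rewrite -rowZ; apply: row_first_rows.
  by rewrite -addnA !ltn_add2l.
have rk : (r <= \rank (first_rows n X (r + (m + m))))%N := leq_trans rZ (mxrankS Zpre).
have := @gs_cmdP _ n m r X s hr hm hn (fun _ _ => erefl) rk.
set s1 := exec gs_cmd s; set P := proj_of _ _ _ _.
move=> [c1 D1 [pP tP] hA hS].
set s2 := exec res_cmd s1.
have i1 a l : a \notin [:: 8; 9; 10; 11; 12]%N -> imem s1 a l = imem s a l.
  by move=> al; rewrite /s1 (@frame_regs _ [:: 8; 9; 10; 11; 12]%N).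
have i2 a l : a \notin [:: 9; 10; 11; 12]%N -> imem s2 a l = imem s1 a l.
  by move=> al; rewrite /s2 (@frame_regs _ [:: 9; 10; 11; 12]%N).
have z1 : smem s1 15 0 0 = 0.
  have : gs_inv n m r X (r + (m + m)) s1 by exact: gs_cmd_inv.
  by case=> c _ [[]].
have Q2 x y : smem s2 3 x y = smem s1 3 x y by rewrite /s2 frame_sc.
have D2 x y : smem s2 4 x y = smem s1 4 x y by rewrite /s2 frame_sc.
have P2 : proj_of n (r + r) (smem s2 3) (smem s2 4) = P by apply: proj_of_eq.
have E2 : mx_of m n (smem s2 5) = B *m (1%:M - P).
  rewrite /s2 (@res_cmdP _ s1 m n r) ?i1 //; congr (_ *m _).
  by apply/matrixP=> i j; rewrite mxE /s1 frame_sc // hB.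
have r2 : ieval s2 (reg 2) = r by rewrite -hr -(i1 2%N) // -i2.
have z2 : smem s2 15 0 0 = 0 by rewrite /s2 frame_sc.
clearbody s2; clearbody s1; rewrite execFor r2; set s3 := iteri _ _ _.
have : loop_inv r out P (B *m (1%:M - P)) (smem s1 3) r s3.
  apply: (iteri_ind (P := loop_inv r out P (B *m (1%:M - P)) (smem s1 3))).
    split; first by split; rewrite ?i2 ?c1 ?i1 ?addn0.
    split=> [k|k b _|]; rewrite ?D2 ?Q2 ?addn0 //; first exact: D1.
    exists 1%:M; rewrite P2 E2; apply: greedy_init => //.
    by rewrite -mulmxA mulmxBl mul1mx pP.2 subrr mulmx0.
  by move=> k s4; exact: loop_step.
case=> _ [_ Q3 [T inv]].
have [J [Y [fJ sel]]] := greedy_end pP inv.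
exists P, J, Y; split=> //; split=> //.
- apply/row_matrixP=> k; rewrite row_mul -rowW; exact: hA.
- move=> WB rB; apply: submx_trans (hS (r + m)%N _) _.
    apply: leq_trans rB (mxrankS _); apply/row_subP=> i; rewrite -rowB.
    by apply: row_first_rows; rewrite ltn_add2l.
  apply/row_subP=> u; rewrite (_ : row u _ = row_of n X u); last first.
    by apply/rowP=> j; rewrite !mxE.
  case: (ltnP u r) => [ur|ru].
    by rewrite (rowW (Ordinal ur)); apply: submx_trans WB; exact: row_sub.
  have um : (u - r < m)%N by rewrite ltn_subLR.
  by rewrite -(subnKC ru) (rowB (Ordinal um)) row_sub.
(* Transposing the sum of the q^* q / d gives the sum of the q^T conj(q) / d; after Gram-Schmidt
   only the first r of the 2r weights are nonzero. *)
- split=> //; exists (\matrix_(a < n, k < r) (smem s1 3 k a / smem s1 4 k 0)).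
  apply/matrixP=> a b; rewrite !mxE big_split_ord /=.
  rewrite [X in _ + X]big1 ?addr0 => [|k _]; last first.
    by rewrite D1 ?invr0 ?mulr0 // leq_addr ltn_add2l ltn_ord.
  apply: eq_bigr => k _; rewrite !mxE Q3 //.
  by rewrite -mulrA mulrC.
Qed.

End Selection.

(** * The complete program *)

Definition load_data (eW eB eZ : sexp) : cmd :=
  CSeq (fill 2 (INum 0) (reg 2) (reg 7) 10 11 eW)
  (CSeq (fill 2 (reg 2) (reg 6) (reg 7) 10 11 eB)
        (fill 2 (IAdd (reg 2) (reg 6)) (reg 6) (reg 7) 10 11 eZ)).

(* [mr] and [nr] are the registers (0 or 1) holding the size of the matrix to
   process, which is [A], [Z] or a transpose. *)
Definition phase_cmd (mr nr : nat) (eW eB eZ : sexp) (out : nat) : cmd :=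
  CSeq (CSeq (CISet 6 (INum 0) (reg mr)) (CISet 7 (INum 0) (reg nr)))
  (CSeq (load_data eW eB eZ) (select_cmd out)).

Definition normal_entry (a : nat) : sexp := cell a (reg 10) (reg 11).
Definition transp_entry (a : nat) : sexp := cell a (reg 11) (reg 10).

(** For r = 0 the budget M N r is 0, so no operation may be executed. The first phase is run for its
    Gram-Schmidt vectors; the last one reads the rows selected by the third in integer array 3. *)
Definition cross_cmd : cmd :=
  CIfI (reg 2) (INum 0) CSkip
  (CSeq (phase_cmd 1 0 (SNum 0) (transp_entry 1) (transp_entry 1) 15)
  (CSeq (phase_cmd 0 1
           (SSum 12 (reg 6) (SOp OpMul (SConj (cell 3 (reg 10) (reg 12)))
                                       (cell 0 (reg 12) (reg 11))))
           (normal_entry 0) (normal_entry 1) 4)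
  (CSeq (phase_cmd 1 0
           (SSum 12 (reg 6) (SOp OpMul (SConj (cell 3 (reg 10) (reg 12)))
                                       (cell 0 (reg 11) (reg 12))))
           (transp_entry 0) (transp_entry 1) 3)
        (phase_cmd 0 1 (cell 0 (IAt 3 (reg 10)) (reg 11))
           (normal_entry 0) (normal_entry 1) 5)))).

Section Program.
Variable R : realType.
Notation C := R[i].
Implicit Types (s : state R).

(** The monomials that occur in the operation counts, each absorbed by m n r; the numerical
    constants are deliberately generous. *)
Lemma mnr_bounds m n r (p := (m * n * r)%N) : (0 < r)%N -> (r <= m)%N -> (r <= n)%N ->
  [/\ 1 <= p, r <= p, m <= p & n <= p]%N /\
  [/\ m * n <= p, m * r <= p, n * r <= p & r * r <= p]%N /\
  [/\ r * r * m <= p & r * r * n <= p]%N.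
Proof.
rewrite {}/p => r0 rm rn; have m0 : (0 < m)%N by lia. have n0 : (0 < n)%N by lia.
have a : (m * r <= m * n * r)%N by rewrite leq_mul2r leq_pmulr ?orbT.
have b : (n * r <= m * n * r)%N by rewrite leq_mul2r leq_pmull ?orbT.
have c : (r * r * m <= m * n * r)%N by nia.
have d : (r * r * n <= m * n * r)%N by nia.
have e : (m * n <= m * n * r)%N by rewrite leq_pmulr.
by do !split => //; nia.
Qed.

Lemma cost_select_cmd s m n r out :
  imem s 6 0 = m -> imem s 7 0 = n -> imem s 2 0 = r ->
  (0 < r)%N -> (r <= m)%N -> (r <= n)%N ->
  (cost s (select_cmd out) <= 1000 * (m * n * r))%N.
Proof.
move=> hm hn hr r0 rm rn.
rewrite /select_cmd /gs_cmd /clear_cmd /gs_body /gs_coef_cmd /gs_resid_cmd /gs_norm_cmd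
  /append_cmd /res_cmd /res_coef_cmd /res_fill_cmd /greedy_body /greedy_core /score_cmd
  /diag_cmd /colnorm_cmd /trace_cmd /total_cmd /lhs_cmd /rhs_cmd /scan_cmd /scan_body
  /pivot_cmd /proj_row_cmd /update_cmd /copy_back_cmd /weight_cmd /append_cmd /fill /=.
rewrite hm hn hr !max0n.
have [[p1 p2 p3 p4] [[p5 p6 p7 p8] [p9 p10]]] := mnr_bounds r0 rm rn.
nia.
Qed.

Lemma writes_int_compile d e : writes_int (compile d e) = sum_regs e.
Proof.
by elim: e d => //= [e IH|o e1 IH1 e2 IH2|a b e IH] d; rewrite ?IH ?IH1 ?IH2 ?cats0.
Qed.

Lemma writes_sc_compile d e a : (a < d)%N -> a \notin writes_sc (compile d e).
Proof.
elim: e d => /= [l|k|e IH|o e1 IH1 e2 IH2|b c e IH] d ad;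
  rewrite ?inE ?mem_cat ?inE ?(ltn_eqF ad) ?negb_or ?IH ?IH1 ?IH2 ?andbT //; exact: leqW.
Qed.

Lemma frame_fill_int (L : seq nat) a row0 ei ej i j e s b l :
  {subset [:: i, j & sum_regs e] <= L} -> b \notin L ->
  imem (exec (fill a row0 ei ej i j e) s) b l = imem s b l.
Proof.
move=> sub bL; apply: frame_int; apply: contra bL; rewrite /fill /= writes_int_compile cats0.
exact: sub.
Qed.

Lemma frame_fill_sc a row0 ei ej i j e s b x y :
  (b < tmp_base)%N -> b != a ->
  smem (exec (fill a row0 ei ej i j e) s) b x y = smem s b x y.
Proof.
move=> bT ba; apply: frame_sc; rewrite /fill /= mem_cat negb_or writes_sc_compile //.
by rewrite inE.
Qed.

(* Entry expressions are evaluated when [load_data] has already written part of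
   its output, so they may only depend on what [same_input] preserves. *)
Definition same_input s s' : Prop :=
  (forall a l, a \notin [:: 6; 7; 8; 9; 10; 11; 12; 13; 14]%N -> imem s' a l = imem s a l) /\
  (forall a x y, a \in [:: 0; 1; 3]%N -> smem s' a x y = smem s a x y).

Definition evals_to s (m n p q : nat) (e : sexp) (D : 'M[C]_(p, q)) : Prop :=
  forall s', same_input s s' -> imem s' 6 0 = m -> imem s' 7 0 = n ->
  forall (x : 'I_p) (y : 'I_q), seval (iset (iset s' 10 0 x) 11 0 y) e = D x y.

Lemma load_dataP s0 s m n r eW eB eZ (W : 'M[C]_(r, n)) (B Zb : 'M[C]_(m, n))
    (s' := exec (load_data eW eB eZ) s) :
  same_input s0 s -> imem s 6 0 = m -> imem s 7 0 = n -> imem s 2 0 = r ->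
  {subset sum_regs eW ++ sum_regs eB ++ sum_regs eZ <= [:: 12]%N} ->
  fill_wf 2 (INum 0) (reg 7) 10 11 eW -> fill_wf 2 (reg 2) (reg 7) 10 11 eB ->
  fill_wf 2 (IAdd (reg 2) (reg 6)) (reg 7) 10 11 eZ ->
  evals_to s0 m n eW W -> evals_to s0 m n eB B -> evals_to s0 m n eZ Zb ->
  [/\ forall a l, a \notin [:: 10; 11; 12]%N -> imem s' a l = imem s a l,
      forall a x y, (a < tmp_base)%N -> a != 2 -> smem s' a x y = smem s a x y,
      forall (k : 'I_r) (j : 'I_n), smem s' 2 k j = W k j,
      forall (k : 'I_m) (j : 'I_n), smem s' 2 (r + k) j = B k j
    & forall (k : 'I_m) (j : 'I_n), smem s' 2 (r + m + k) j = Zb k j].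
Proof.
move=> [sI sS] hm hn hr sub wW wB wZ vW vB vZ.
have subE e : {subset sum_regs e <= sum_regs eW ++ sum_regs eB ++ sum_regs eZ} ->
    {subset [:: 10, 11 & sum_regs e]%N <= [:: 10; 11; 12]%N}.
  move=> se x; rewrite !inE => /or3P[->|->|/se/sub]; rewrite ?orbT // inE => ->.
  by rewrite !orbT.
have subW : {subset [:: 10, 11 & sum_regs eW]%N <= [:: 10; 11; 12]%N}.
  by apply: subE => x xW; rewrite mem_cat xW.
have subB : {subset [:: 10, 11 & sum_regs eB]%N <= [:: 10; 11; 12]%N}.
  by apply: subE => x xB; rewrite !mem_cat xB orbT.
have subZ : {subset [:: 10, 11 & sum_regs eZ]%N <= [:: 10; 11; 12]%N}.
  by apply: subE => x xZ; rewrite !mem_cat xZ !orbT.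
rewrite {}/s' /load_data 2!execS; set s1 := exec (fill _ _ _ _ _ _ eW) s.
set s2 := exec (fill _ _ _ _ _ _ eB) s1; set s3 := exec (fill _ _ _ _ _ _ eZ) s2.
have i1 a l : a \notin [:: 10; 11; 12]%N -> imem s1 a l = imem s a l.
  by move=> al; rewrite /s1 (frame_fill_int _ _ _ _ _ _ subW).
have i2 a l : a \notin [:: 10; 11; 12]%N -> imem s2 a l = imem s a l.
  by move=> al; rewrite /s2 (frame_fill_int _ _ _ _ _ _ subB) ?i1.
have i3 a l : a \notin [:: 10; 11; 12]%N -> imem s3 a l = imem s a l.
  by move=> al; rewrite /s3 (frame_fill_int _ _ _ _ _ _ subZ) ?i2.
have m1 a x y : (a < tmp_base)%N -> a != 2 -> smem s1 a x y = smem s a x y.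
  by move=> aT a2; rewrite /s1 frame_fill_sc.
have m2 a x y : (a < tmp_base)%N -> a != 2 -> smem s2 a x y = smem s a x y.
  by move=> aT a2; rewrite /s2 frame_fill_sc ?m1.
have m3 a x y : (a < tmp_base)%N -> a != 2 -> smem s3 a x y = smem s a x y.
  by move=> aT a2; rewrite /s3 frame_fill_sc ?m2.
have small a : a \in [:: 0; 1; 3]%N -> (a < tmp_base)%N && (a != 2).
  by rewrite !inE => /or3P[] /eqP->.
have same s4 : (forall a l, a \notin [:: 10; 11; 12]%N -> imem s4 a l = imem s a l) ->
   (forall a x y, (a < tmp_base)%N -> a != 2 -> smem s4 a x y = smem s a x y) ->
   same_input s0 s4.
  move=> i4 m4; split=> [a l al|a x y ha]; last first.
    by have /andP[aT a2] := small a ha; rewrite m4 // sS.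
  rewrite i4 ?sI //; apply: contra al; rewrite !inE.
  by case/or3P=> ->; rewrite ?orbT.
have r1 : ieval s1 (reg 2) = r by rewrite -hr -(i1 2%N).
have n1 : ieval s1 (reg 7) = n by rewrite -hn -(i1 7%N).
have k1 : ieval s1 (reg 6) = m by rewrite -hm -(i1 6%N).
have n2 : ieval s2 (reg 7) = n by rewrite -hn -(i2 7%N).
have k2 : ieval s2 (reg 6) = m by rewrite -hm -(i2 6%N).
have rm2 : ieval s2 (IAdd (reg 2) (reg 6)) = (r + m)%N.
  by rewrite -hr -hm -(i2 2%N) // -(i2 6%N).
have n0 : ieval s (reg 7) = n by []. have r0 : ieval s (reg 2) = r by [].
have same1 : same_input s0 s1 by apply: same i1 m1.
have same2 : same_input s0 s2 by apply: same i2 m2.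
have i1m : imem s1 6 0 = m by []. have i1n : imem s1 7 0 = n by [].
have i2m : imem s2 6 0 = m by []. have i2n : imem s2 7 0 = n by [].
split.
- exact: i3.
- exact: m3.
- move=> k j; have kr := ltn_ord k.
  rewrite /s3 fillP // rm2 (_ : [&& _, _ & _] = false); last by lia.
  rewrite /s2 fillP // r1 (_ : [&& _, _ & _] = false); last by lia.
  rewrite -[nat_of_ord k]add0n; rewrite -(vW s (conj sI sS) hm hn k j).
  by apply: (@fill_at _ _ (INum 0)) => //; rewrite ?r0 ?n0.
- move=> k j; have km := ltn_ord k.
  rewrite /s3 fillP // rm2 (_ : [&& _, _ & _] = false); last by lia.
  rewrite -(vB s1 same1 i1m i1n k j) -r1.
  by apply: fill_at; rewrite ?k1 ?n1.
- move=> k j; rewrite -(vZ s2 same2 i2m i2n k j) -rm2.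
  by apply: fill_at; rewrite ?k2 ?n2.
Qed.

Lemma phase_cmdP s mr nr m n r eW eB eZ out (W : 'M[C]_(r, n)) (B Zb : 'M[C]_(m, n))
    (s' := exec (phase_cmd mr nr eW eB eZ out) s) :
  mr \in [:: 0; 1]%N -> nr \in [:: 0; 1]%N -> out \in [:: 3; 4; 5; 15]%N ->
  imem s mr 0 = m -> imem s nr 0 = n -> imem s 2 0 = r ->
  (0 < r)%N -> (r <= m)%N -> (r <= n)%N -> (r <= \rank Zb)%N ->
  {subset sum_regs eW ++ sum_regs eB ++ sum_regs eZ <= [:: 12]%N} ->
  fill_wf 2 (INum 0) (reg 7) 10 11 eW -> fill_wf 2 (reg 2) (reg 7) 10 11 eB ->
  fill_wf 2 (IAdd (reg 2) (reg 6)) (reg 7) 10 11 eZ ->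
  evals_to s m n eW W -> evals_to s m n eB B -> evals_to s m n eZ Zb ->
  bounds_avoid (writes_int (load_data eW eB eZ)) (load_data eW eB eZ) ->
  (forall s1, imem s1 6 0 = m -> imem s1 7 0 = n -> imem s1 2 0 = r ->
     (cost s1 (load_data eW eB eZ) <= 100 * (m * n * r))%N) ->
  [/\ exists P J Y, phase_spec W B P (mx_of r n (smem s' 3)) J Y /\
        forall k : 'I_r, imem s' out k = J k,
      forall a l, a \notin [:: out; 6; 7; 8; 9; 10; 11; 12; 13; 14]%N ->
        imem s' a l = imem s a l,
      forall a x y, a \in [:: 0; 1]%N -> smem s' a x y = smem s a x y
    & (ops s' <= ops s + 1100 * (m * n * r))%N].
Proof.
move=> hmr hnr hout hm hn hr r0 rm rn rZ sub wW wB wZ vW vB vZ bL costL.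
rewrite {}/s' /phase_cmd 2!execS.
set s1 := exec (CSeq _ _) s; set s2 := exec (load_data _ _ _) s1.
have i1 a l : a \notin [:: 6; 7]%N -> imem s1 a l = imem s a l.
  by move=> al; rewrite /s1 (@frame_regs _ [:: 6; 7]%N).
have S1 a x y : smem s1 a x y = smem s a x y by rewrite /s1 frame_sc.
have o1 : ops s1 = ops s by [].
have [m1 n1] : imem s1 6 0 = m /\ imem s1 7 0 = n.
  rewrite /s1 execS !imem_CISet /= -hm -hn; split=> //.
  by move: hnr; rewrite !inE => /orP[] /eqP->.
have r1 : imem s1 2 0 = r by rewrite i1.
clearbody s1.
have same : same_input s s1.
  split=> // a l al; apply: i1; apply: contra al; rewrite !inE.
  by case/orP=> ->; rewrite ?orbT.
have [i2 S2 hW hB hZ] := load_dataP same m1 n1 r1 sub wW wB wZ vW vB vZ.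
rewrite -/s2 in i2 S2 hW hB hZ.
have o2 : (ops s2 <= ops s1 + 100 * (m * n * r))%N.
  by apply: leq_trans (ops_le_cost _ bL) _; rewrite leq_add2l costL.
clearbody s2.
have m2 : imem s2 6 0 = m by rewrite i2.
have n2 : imem s2 7 0 = n by rewrite i2.
have r2 : imem s2 2 0 = r by rewrite i2.
have ook : out \notin [:: 2; 6; 7; 8; 9; 10; 11; 12; 13; 14]%N.
  by move: hout; rewrite !inE => /or4P[] /eqP->.
split.
- exact: select_cmdP ook m2 n2 r2 hW hB hZ rZ.
- move=> a l al; rewrite (@frame_regs _ [:: out; 8; 9; 10; 11; 12; 13; 14]%N).
  + rewrite i2 ?i1 //; apply: contra al; rewrite !inE.
      by case/orP=> ->; rewrite ?orbT.
    by case/or3P=> ->; rewrite ?orbT.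
  + by move: hout; rewrite !inE => /or4P[] /eqP->.
  + apply: contra al; rewrite !inE; case/orP=> [->//|].
    by do 6?[case/orP]; move=> ->; rewrite ?orbT.
- move=> a x y; rewrite !inE => /orP[] /eqP->; rewrite frame_sc ?S2 ?S1 //.
- have := ops_le_cost (c := select_cmd out) s2; set bs := bounds_avoid _ _.
  have -> : bs by rewrite /bs; move: hout; rewrite !inE => /or4P[] /eqP->.
  move=> /(_ isT) h; have := cost_select_cmd out m2 n2 r2 r0 rm rn.
  by rewrite o1 in o2; lia.
Qed.

End Program.

(** * Running the four phases *)

Section Main.
Variable R : realType.
Notation C := R[i].
Implicit Types (s : state R).

(** Lets the case r = 0, in which nothing is executed, go through the same error bounds. *)
Lemma phase_spec_rank0 m n (W Q Y : 'M[C]_(0, n)) (B : 'M[C]_(m, n)) J :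
  phase_spec W B 0 Q J Y.
Proof.
have B0 : B - colsub J B *m Y = B by rewrite [Y]flatmx0 mulmx0 subr0.
split.
- by split; rewrite ?mulmx0 ?ctrmx0.
- by rewrite mxtrace0.
- by rewrite [W]flatmx0 mul0mx.
- by rewrite sub0mx.
split; first by exists 0; rewrite mul0mx trmx0.
split; rewrite ?B0 ?subr0 ?mulmx1 ?mul1r //; first by case.
by move=> k D; rewrite mulmx0 [Y]flatmx0 mulmx0.
Qed.

Lemma entry_ord M N (A : 'M[C]_(M, N)) (i : 'I_M) (j : 'I_N) : entry A i j = A i j.
Proof. by rewrite /entry !valK. Qed.

Lemma evals_normal s m n a (D : 'M[C]_(m, n)) :
  a \in [:: 0; 1]%N -> (forall (i : 'I_m) (j : 'I_n), smem s a i j = D i j) ->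
  evals_to s m n (normal_entry a) D.
Proof.
move=> ha hD s' [_ sS] _ _ i j; rewrite -hD -sS //.
by move: ha; rewrite !inE => /orP[] ->; rewrite ?orbT.
Qed.

Lemma evals_transp s m n a (D : 'M[C]_(n, m)) :
  a \in [:: 0; 1]%N -> (forall (i : 'I_n) (j : 'I_m), smem s a i j = D i j) ->
  evals_to s m n (transp_entry a) D^T.
Proof.
move=> ha hD s' [_ sS] _ _ i j; rewrite mxE -hD -sS //.
by move: ha; rewrite !inE => /orP[] ->; rewrite ?orbT.
Qed.

Lemma cross_cmdP M N r (A Z : 'M[C]_(M, N)) (s := exec cross_cmd (init r A Z)) :
  \rank Z = r ->
  (ops s <= 4400 * (M * N * r))%N /\
  exists (PA : 'M[C]_M) QA JA YA (PB : 'M[C]_N) QB J YB (PC : 'M[C]_M) QC I YC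
      (PD : 'M[C]_N) QD J' YD,
  [/\ phase_spec (0 : 'M[C]_(r, M)) Z^T PA QA JA YA,
      phase_spec (map_mx Num.conj QA *m A) A PB QB J YB,
      phase_spec (map_mx Num.conj QB *m A^T) A^T PC QC I YC
    & phase_spec (rowsub I A) A PD QD J' YD] /\
  [/\ forall k : 'I_r, imem s 3 k = I k, forall k : 'I_r, imem s 4 k = J k
    & forall k : 'I_r, imem s 5 k = J' k].
Proof.
move=> rZ; rewrite {}/s; set s0 := init r A Z.
have [Mreg Nreg rreg] : [/\ imem s0 0 0 = M, imem s0 1 0 = N & imem s0 2 0 = r] by [].
have A0 (i : 'I_M) (j : 'I_N) : smem s0 0 i j = A i j by exact: entry_ord.
have Z0 (i : 'I_M) (j : 'I_N) : smem s0 1 i j = Z i j by exact: entry_ord.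
have o0 : ops s0 = 0%N by [].
clearbody s0; rewrite /cross_cmd execIfI (rreg : ieval s0 (reg 2) = r).
rewrite -[ieval s0 (INum 0)]/0%N; case: (leqP r 0) => [|r0].
  rewrite leqn0 => /eqP r0; split; first exact: leq_trans (eq_leq o0) _.
  clear rreg; subst r; rewrite r0 {r0 o0}.
  have noM : 'I_0 -> 'I_M by case.
  have noN : 'I_0 -> 'I_N by case.
  exists 0, 0, noM, 0, 0, 0, noN, 0, 0, 0, noM, 0, 0, 0, noN, 0.
  by split; [split; exact: phase_spec_rank0 | split; case].
have rM : (r <= M)%N by rewrite -rZ rank_leq_row.
have rN : (r <= N)%N by rewrite -rZ rank_leq_col.
have rZT : (r <= \rank Z^T)%N by rewrite mxrank_tr rZ.
have rZ' : (r <= \rank Z)%N by rewrite rZ.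
have boundsMN := mnr_bounds r0 rM rN; have boundsNM := mnr_bounds r0 rN rM.
rewrite 3!execS; set s1 := exec (phase_cmd _ _ _ _ _ _) s0.
have [] := @phase_cmdP _ s0 1 0 N M r (SNum 0) (transp_entry 1) (transp_entry 1) 15
  0 Z^T Z^T isT isT isT Nreg Mreg rreg r0 rN rM rZT.
- by [].
- by [].
- by [].
- by [].
- by move=> s' _ _ _ x y; rewrite mxE.
- exact: evals_transp.
- exact: evals_transp.
- by [].
- move=> s' h6 h7 h2; rewrite /load_data /fill /= h6 h7 h2.
  by case: boundsNM => [[? ? ? ?] [[? ? ? ?] [? ?]]]; nia.
rewrite -/s1 => [[PA [JA [YA [specA _]]]] i1 S1 o1].
set QA := mx_of r M (smem s1 3) in specA.
have QA1 (k : 'I_r) (j : 'I_M) : smem s1 3 k j = QA k j by rewrite mxE.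
clearbody s1 QA.
have [M1 N1 r1] : [/\ imem s1 0 0 = M, imem s1 1 0 = N & imem s1 2 0 = r] by rewrite !i1.
have A1 (i : 'I_M) (j : 'I_N) : smem s1 0 i j = A i j by rewrite S1.
have Z1 (i : 'I_M) (j : 'I_N) : smem s1 1 i j = Z i j by rewrite S1.
set s2 := exec (phase_cmd _ _ _ _ _ _) s1.
have [] := @phase_cmdP _ s1 0 1 M N r
  (SSum 12 (reg 6) (SOp OpMul (SConj (cell 3 (reg 10) (reg 12))) (cell 0 (reg 12) (reg 11))))
  (normal_entry 0) (normal_entry 1) 4 (map_mx Num.conj QA *m A) A Z isT isT isT
  M1 N1 r1 r0 rM rN rZ'.
- by [].
- by [].
- by [].
- by [].
- move=> s' [_ sS] h6 _ x y; rewrite mxE.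
  rewrite (eq_bigr (fun k : 'I_M => Num.conj (smem s' 3 x k) * smem s' 0 k y)).
    by rewrite -h6.
  by move=> k _; rewrite mxE -QA1 -A1 -!sS.
- exact: evals_normal.
- exact: evals_normal.
- by [].
- move=> s' h6 h7 h2; rewrite /load_data /fill /= h6 h7 h2.
  by case: boundsMN => [[? ? ? ?] [[? ? ? ?] [? ?]]]; nia.
rewrite -/s2 => [[PB [J [YB [specB J2]]]] i2 S2 o2].
set QB := mx_of r N (smem s2 3) in specB.
have QB2 (k : 'I_r) (j : 'I_N) : smem s2 3 k j = QB k j by rewrite mxE.
clearbody s2 QB.
have [M2 N2 r2] : [/\ imem s2 0 0 = M, imem s2 1 0 = N & imem s2 2 0 = r] by rewrite !i2.
have A2 (i : 'I_M) (j : 'I_N) : smem s2 0 i j = A i j by rewrite S2.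
have Z2 (i : 'I_M) (j : 'I_N) : smem s2 1 i j = Z i j by rewrite S2.
set s3 := exec (phase_cmd _ _ _ _ _ _) s2.
have [] := @phase_cmdP _ s2 1 0 N M r
  (SSum 12 (reg 6) (SOp OpMul (SConj (cell 3 (reg 10) (reg 12))) (cell 0 (reg 11) (reg 12))))
  (transp_entry 0) (transp_entry 1) 3 (map_mx Num.conj QB *m A^T) A^T Z^T isT isT isT
  N2 M2 r2 r0 rN rM rZT.
- by [].
- by [].
- by [].
- by [].
- move=> s' [_ sS] h6 _ x y; rewrite mxE.
  rewrite (eq_bigr (fun k : 'I_N => Num.conj (smem s' 3 x k) * smem s' 0 y k)).
    by rewrite -h6.
  by move=> k _; rewrite !mxE -QB2 -A2 -!sS.
- exact: evals_transp.
- exact: evals_transp.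
- by [].
- move=> s' h6 h7 h2; rewrite /load_data /fill /= h6 h7 h2.
  by case: boundsNM => [[? ? ? ?] [[? ? ? ?] [? ?]]]; nia.
rewrite -/s3 => [[PC [I [YC [specC I3]]]] i3 S3 o3].
set QC := mx_of r M (smem s3 3) in specC.
clearbody s3 QC.
have [M3 N3 r3] : [/\ imem s3 0 0 = M, imem s3 1 0 = N & imem s3 2 0 = r] by rewrite !i3.
have A3 (i : 'I_M) (j : 'I_N) : smem s3 0 i j = A i j by rewrite S3.
have Z3 (i : 'I_M) (j : 'I_N) : smem s3 1 i j = Z i j by rewrite S3.
set s4 := exec (phase_cmd _ _ _ _ _ _) s3.
have [] := @phase_cmdP _ s3 0 1 M N r (cell 0 (IAt 3 (reg 10)) (reg 11))
  (normal_entry 0) (normal_entry 1) 5 (rowsub I A) A Z isT isT isT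
  M3 N3 r3 r0 rM rN rZ'.
- by [].
- by [].
- by [].
- by [].
- move=> s' [sI sS] _ _ x y; rewrite mxE -A3 -I3 -sS // -sI //.
- exact: evals_normal.
- exact: evals_normal.
- by [].
- move=> s' h6 h7 h2; rewrite /load_data /fill /= h6 h7 h2.
  by case: boundsMN => [[? ? ? ?] [[? ? ? ?] [? ?]]]; nia.
rewrite -/s4 => [[PD [J' [YD [specD J'4]]]] i4 S4 o4].
set QD := mx_of r N (smem s4 3) in specD.
clearbody s4 QD.
(* Four phases at 1100 M N r each: 100 for loading and 1000 for the selection. *)
split; first by move: o1 o2 o3 o4; rewrite o0 (mulnC N M); lia.
exists PA, QA, JA, YA, PB, QB, J, YB, PC, QC, I, YC, PD, QD, J', YD.
split; first by split.
by split=> k; [rewrite i4 | rewrite i4 ?i3 | exact: J'4].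
Qed.

End Main.

Theorem theorem2 :
  exists (prog : cmd) (K : nat),
  forall (R : realType) (M N r : nat) (A Z : 'M[R[i]]_(M, N)),
  \rank Z = r ->
  let s := exec prog (init r A Z) in
  (ops s <= K * (M * N * r))%N /\
  exists (I : 'I_r -> 'I_M) (J J' : 'I_r -> 'I_N),
  [/\ selects s 3 I, selects s 4 J & selects s 5 J'] /\
  let Rw := rowsub I A in
  let C := colsub J A in
  let C' := colsub J' A in
  let Ahat := mxsub I J' A in
  [/\ frob_norm (A - C *m pinvmp C *m A *m pinvmp Rw *m Rw)
        <= Num.sqrt (2 * r + 2)%N%:R * frob_norm (A - Z),
      spectral_norm (A - C *m pinvmp C *m A *m pinvmp Rw *m Rw)
        <= Num.sqrt (2 + 2 * r * (minn M N - r))%N%:R * spectral_norm (A - Z)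
    & (* an invertible r x r submatrix of A exists iff r <= \rank A *)
      (r <= \rank A)%N ->
      [/\ Ahat \in unitmx,
          frob_norm (A - C' *m invmx Ahat *m Rw)
            <= (r + 1)%N%:R * frob_norm (A - Z)
        & spectral_norm (A - C' *m invmx Ahat *m Rw)
            <= Num.sqrt (1 + r * (r + 2) * (minn M N - r))%N%:R
               * spectral_norm (A - Z)]].
Proof.
exists cross_cmd, 4400%N => R M N r A Z rZ s.
have [opsP [PA [QA [JA [YA [PB [QB [J [YB [PC [QC [I [YC [PD [QD [J' [YD
  [[sA sB sC sD] [I3 J4 J'5]]]]]]]]]]]]]]]]]]] := cross_cmdP A rZ.
split; first exact: opsP.
exists I, J, J'; split.
  by split; split=> //; [case: sC | case: sB | case: sD] => _ _ _ _ [_ []].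
have [fX bX full] := cross_approximation rZ sA sB sC sD.
split; [exact: frob_norm_le | exact: spectral_norm_le_mul | move=> /full[uA fX' bX']].
split=> //; last exact: spectral_norm_le_mul.
have -> : (r + 1)%N%:R = Num.sqrt ((r + 1) ^ 2)%N%:R :> R.
  by rewrite natrX sqrtr_sqr ger0_norm.
exact: frob_norm_le.
Qed.
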